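(* Let $f_0\in C^1_{x,v}(T\mathbb{H}^2)$, $f_0:T\mathbb{H}^2\to[0,\infty)$, be a compactly supported initial datum for the Vlasov equation on the hyperbolic plane $(\mathbb{H}^2,g_{\mathbb{H}^2})$. Let $f:[0,\infty)\times T\mathbb{H}^2\to[0,\infty)$ be the corresponding solution of the Vlasov equation $\partial_t f+Xf=0$, $f(0,\cdot)=f_0$, and let $\rho(f)$ be its spatial density. Then there is a constant $C>0$, depending only on the support of $f_0$, such that for every $t\ge 1$ and every $x\in\mathbb{H}^2$, $$|\rho(f)(t,x)|\le \frac{C}{t^2}\|f_0\|_{L^\infty_{x,v}},$$ $$\Big|\frac{1}{\sinh r}\partial_\theta\rho(f)(t,x)\Big|\le \frac{C}{t}\|f_0\|_{W^{1,\infty}_{x,v}},\qquad |\partial_r\rho(f)(t,x)|\le \frac{C}{t}\|f_0\|_{W^{1,\infty}_{x,v}},$$ where the derivative estimates are understood at points with $r>0$, where the polar frame is defined.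
   Context: $\mathbb{H}^2$ is hyperbolic space with geodesic polar coordinates $(r,\theta)$ in which $g=g_{\mathbb{H}^2}=\mathrm{d}r^2+\sinh^2 r\,\mathrm{d}\theta^2$; $(r,\theta,v^r,v^\theta)$ are the induced coordinates on $T\mathbb{H}^2$ (so $v=v^r\partial_r+v^\theta\partial_\theta$). $X$ is the generator of the geodesic flow $\phi_t$ on $T\mathbb{H}^2$, and the Vlasov equation reads $$\partial_t f+v^r\partial_r f+v^\theta\partial_\theta f+(v^\theta)^2\sinh r\cosh r\,\partial_{v^r}f-2v^rv^\theta\coth r\,\partial_{v^\theta}f=0,$$ equivalently $f(t,x,v)=f_0(\phi_{-t}(x,v))$. The spatial density is $\rho(f)(t,x)=\int_{T_x\mathbb{H}^2} f(t,x,v)\,\mathrm{dvol}_{T_x\mathbb{H}^2}(v)=\int f(t,x,v)\sinh r\,\mathrm{d}v^r\mathrm{d}v^\theta$. $\|f_0\|_{L^\infty_{x,v}}$ is the supremum of $|f_0|$ and $\|f_0\|_{W^{1,\infty}_{x,v}}$ is the supremum of $|f_0|$ plus the supremum of the norm of its first-order derivatives on $T\mathbb{H}^2$ (measured with the Sasaki metric on $T\mathbb{H}^2$). *)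

(* Defs.v *)
From HB Require Import structures.
From mathcomp Require Import all_boot all_order all_algebra.
From mathcomp Require Import all_classical all_reals all_analysis.
From mathcomp Require Import ring lra.
Import Order.TTheory GRing.Theory Num.Theory.
Import numFieldNormedType.Exports.

Set Implicit Arguments.
Unset Strict Implicit.
Unset Printing Implicit Defensive.

Local Open Scope classical_set_scope.
Local Open Scope ring_scope.

(* The hyperbolic plane is the hyperboloid model
   { (x0, x) in R^{1,2} | x0 ^ 2 - |x| ^ 2 = 1, x0 > 0 } read in the global
   chart x in R^2; the induced metric is
   g_ij = delta_ij - x_i x_j / (1 + |x| ^ 2).
   T H^2 is then R^2 * R^2, with v standing for v_0 d/dx_0 + v_1 d/dx_1. *)
Notation H2 R := 'rV[R]_2.
Notation TH2 R := (('rV[R]_2 * 'rV[R]_2)%type).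

Definition vec2 (R : realType) (a b : R) : 'rV[R]_2 :=
  \row_(i < 2) (if i == 0 then a else b).

Definition sinh (R : realType) (r : R) : R := (expR r - expR (- r)) / 2.
Definition cosh (R : realType) (r : R) : R := (expR r + expR (- r)) / 2.

Definition metric (R : realType) (x : H2 R) : 'M[R]_2 :=
  \matrix_(i, j) ((i == j)%:R
    - x ord0 i * x ord0 j / (1 + \sum_(k < 2) x ord0 k ^+ 2)).

Definition gdot (R : realType) (x : H2 R) (u v : 'rV[R]_2) : R :=
  \sum_(i < 2) \sum_(j < 2) metric x i j * u ord0 i * v ord0 j.

(* Christoffel symbol Gamma^k_ij of the Levi-Civita connection at x. *)
Definition christoffel (R : realType) (x : H2 R) (k i j : 'I_2) : R :=
  2^-1 * \sum_(l < 2) invmx (metric x) k l *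
    ('D_(delta_mx ord0 i) (fun y : H2 R => metric y j l) x
     + 'D_(delta_mx ord0 j) (fun y : H2 R => metric y i l) x
     - 'D_(delta_mx ord0 l) (fun y : H2 R => metric y i j) x).

Definition Gamma (R : realType) (x : H2 R) (u v : 'rV[R]_2) : 'rV[R]_2 :=
  \row_(k < 2) \sum_(i < 2) \sum_(j < 2)
    christoffel x k i j * u ord0 i * v ord0 j.

(* The generator X of the geodesic flow: x' = v, v' = - Gamma_x(v, v). *)
Definition geodesic_field (R : realType) (p : TH2 R) : TH2 R :=
  (p.2, - Gamma p.1 p.2 p.2).

(* A tangent vector w = (xi, eta) of T H^2 at p = (x, v) has horizontal part xi
   and vertical part eta + Gamma_x(v, xi). *)
Definition sasaki (R : realType) (p w : TH2 R) : R :=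
  let vert := w.2 + Gamma p.1 p.2 w.1 in
  gdot p.1 w.1 w.1 + gdot p.1 vert vert.

Definition C1_at (R : realType) (V : normedModType R) (h : V -> R) (p : V) :=
  differentiable h p /\ forall w : V, continuous_at p (fun q => 'D_w h q).

Definition supp (R : realType) (h : TH2 R -> R) : set (TH2 R) :=
  closure [set p | h p != 0].

Definition Linf_norm (R : realType) (h : TH2 R -> R) : \bar R :=
  ereal_sup [set `|h p|%:E | p in [set: TH2 R]].

(* The norm of dh at p is its operator norm for the Sasaki metric. *)
Definition W1inf_norm (R : realType) (h : TH2 R -> R) : \bar R :=
  (Linf_norm h +
   ereal_sup [set `|'D_(pw.2) h pw.1|%:E |
              pw in [set pw : TH2 R * TH2 R | (sasaki pw.1 pw.2 <= 1)%R]])%E.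

(* Classical solutions: continuous up to t = 0, and C^1 with the equation
   holding for t > 0. *)
Definition vlasov_solution (R : realType) (f0 : TH2 R -> R)
    (f : R -> TH2 R -> R) : Prop :=
  [/\ {within [set tp : R * TH2 R | 0 <= tp.1],
         continuous (fun tp : R * TH2 R => f tp.1 tp.2)},
      forall (t : R) (p : TH2 R), 0 < t ->
        C1_at (fun tp : R * TH2 R => f tp.1 tp.2) (t, p),
      forall (t : R) (p : TH2 R), 0 < t ->
        derive1 (fun s : R => f s p) t + 'D_(geodesic_field p) (f t) p = 0
    & forall p : TH2 R, f 0 p = f0 p].

(* On T_x H^2, with linear coordinates v, dvol = sqrt (det g_x) dv. *)
Definition density (R : realType) (h : TH2 R -> R) (x : H2 R) : R :=
  (\int[(@lebesgue_measure R \x @lebesgue_measure R)%E]_(v in [set: (R * R)%type])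
     (h (x, vec2 v.1 v.2) * Num.sqrt (\det (metric x))))%R.

(* Geodesic polar coordinates about the origin of the chart: see polar_metric. *)
Definition polar (R : realType) (r theta : R) : H2 R :=
  vec2 (sinh r * cos theta) (sinh r * sin theta).

(* The point of T H^2 with coordinates (r, theta, v^r, v^theta) = (r, theta, a, b),
   i.e. the vector a d/dr + b d/dtheta at polar r theta. *)
Definition polar_frame (R : realType) (r theta a b : R) : TH2 R :=
  (polar r theta,
   vec2 (a * (cosh r * cos theta) - b * (sinh r * sin theta))
        (a * (cosh r * sin theta) + b * (sinh r * cos theta))).

Lemma is_derive_coord (R : realType) (x v : 'rV[R]_2) (i : 'I_2) :
  is_derive x v (fun y : 'rV[R]_2 => y ord0 i) (v ord0 i).
Proof.
suff H : h^-1 *: ((h *: v + x) ord0 i - x ord0 i) @[h --> (0:R)^'] --> v ord0 i.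
  by split; [apply: cvgP H | exact: (cvg_lim _ H)].
apply: cvg_near_cst.
apply: filterS (nbhs_dnbhs_neq (0 : R)) => h h0.
by rewrite !mxE addrK /GRing.scale /= mulrA mulVf ?mul1r.
Qed.

Lemma sum_sq_gt0 (R : realType) (x : 'rV[R]_2) :
  0 < 1 + \sum_(k < 2) x ord0 k ^+ 2.
Proof. by rewrite ltr_pwDl // sumr_ge0 // => k _; exact: sqr_ge0. Qed.


Lemma is_deriveC_fun (R : realType) (V : normedModType R) (x v : V) (c : R) : is_derive x v (fun _ : V => c) 0.
Proof. exact: is_derive_cst. Qed.
Lemma is_deriveD_fun (R : realType) (V : normedModType R) (f g : V -> R) (x v : V) (a b : R) : is_derive x v f a -> is_derive x v g b ->
  is_derive x v (fun y => f y + g y) (a + b).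
Proof. move=> ? ?; exact: is_deriveD. Qed.
Lemma is_deriveN_fun (R : realType) (V : normedModType R) (f : V -> R) (x v : V) (a : R) : is_derive x v f a ->
  is_derive x v (fun y => - f y) (- a).
Proof. move=> ?; exact: is_deriveN. Qed.
Lemma is_deriveM_fun (R : realType) (V : normedModType R) (f g : V -> R) (x v : V) (a b : R) : is_derive x v f a -> is_derive x v g b ->
  is_derive x v (fun y => f y * g y) (f x * b + g x * a).
Proof. move=> ? ?; exact: is_deriveM. Qed.
Lemma is_deriveV_fun (R : realType) (V : normedModType R) (f : V -> R) (x v : V) (a : R) : is_derive x v f a -> f x != 0 ->
  is_derive x v (fun y => (f y)^-1) (- (f x) ^- 2 * a).
Proof.
move=> [df1 df2] fx0; split; first exact: derivableV.
by rewrite deriveV // df2.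
Qed.

Lemma sum2 (V : nmodType) (F : 'I_2 -> V) : \sum_(i < 2) F i = F 0 + F 1.
Proof. by rewrite big_ord_recl big_ord1; congr (_ + F _); apply/val_inj. Qed.

Lemma derive_metric (R : realType) (x v : 'rV[R]_2) (i j : 'I_2) :
  let s := 1 + (x ord0 0 ^+ 2 + x ord0 1 ^+ 2) in
  'D_v (fun y : H2 R => metric y i j) x =
   - ((v ord0 i * x ord0 j + x ord0 i * v ord0 j) / s)
   + x ord0 i * x ord0 j * (2 * (x ord0 0 * v ord0 0 + x ord0 1 * v ord0 1)) / s ^+ 2.
Proof.
move=> s.
have s0 : s != 0 by rewrite gt_eqF // /s -(sum2 (fun i => x ord0 i ^+ 2)) sum_sq_gt0.
rewrite (_ : (fun y => _) = (fun y : H2 R => (i == j)%:R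
    - (y ord0 i * y ord0 j) * (1 + (y ord0 0 * y ord0 0 + y ord0 1 * y ord0 1))^-1)); last first.
  by apply/funext => y; rewrite mxE sum2 !expr2.
have C k := @is_derive_coord R x v k.
have s0' : 1 + (x ord0 0 * x ord0 0 + x ord0 1 * x ord0 1) != 0 by rewrite -!expr2.
have [_ ->] := is_deriveD_fun (is_deriveC_fun x v ((i==j)%:R)) (is_deriveN_fun (is_deriveM_fun (is_deriveM_fun (C i) (C j)) (is_deriveV_fun (is_deriveD_fun (is_deriveC_fun x v 1) (is_deriveD_fun (is_deriveM_fun (C 0) (C 0)) (is_deriveM_fun (C 1) (C 1)))) s0'))).
by rewrite /s in s0 *; field; rewrite !expr2.
Qed.

Lemma invmx_metric (R : realType) (x : 'rV[R]_2) :
  invmx (metric x) = \matrix_(i, j) ((i == j)%:R + x ord0 i * x ord0 j).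
Proof.
set B := (X in _ = X).
have : 1 + (x ord0 0 ^+ 2 + x ord0 1 ^+ 2) != 0.
  by rewrite -(sum2 (fun i => x ord0 i ^+ 2)) gt_eqF // sum_sq_gt0.
move=> s0.
have AB : metric x *m B = 1%:M.
  apply/matrixP => i j; rewrite !mxE sum2 !mxE !sum2.
  case/boolP: (i == 0) => [/eqP ->|]; [|move=> i0; have -> : i = 1 by case: i i0 => [[|[|//]]] //= Hi _; apply/val_inj];
  (case/boolP: (j == 0) => [/eqP ->|]; [|move=> j0; have -> : j = 1 by case: j j0 => [[|[|//]]] //= Hj _; apply/val_inj]);
  rewrite !eqxx ?[(1 == 0 :> 'I_2)]eqE ?[(0 == 1 :> 'I_2)]eqE /=; field; rewrite ?addrA // in s0 *.
have U : metric x \in unitmx by case/mulmx1_unit: AB.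
by rewrite -[RHS]mul1mx -(mulVmx U) -mulmxA AB mulmx1.
Qed.

Lemma christoffelE (R : realType) (x : H2 R) (k i j : 'I_2) :
  christoffel x k i j = - x ord0 k * metric x i j.
Proof.
have s0 : 1 + (x ord0 0 ^+ 2 + x ord0 1 ^+ 2) != 0.
  by rewrite -(sum2 (fun i => x ord0 i ^+ 2)) gt_eqF // sum_sq_gt0.
rewrite /christoffel invmx_metric sum2 !derive_metric !mxE !sum2.
have E : forall i : 'I_2, i = 0 \/ i = 1.
  by case=> [[|[|//]]] Hi; [left|right]; apply/val_inj.
case: (E k) => ->; case: (E i) => ->; case: (E j) => ->;
rewrite /= ?eqxx ?[(1 == 0 :> 'I_2)]eqE ?[(0 == 1 :> 'I_2)]eqE /=; field; rewrite ?addrA // in s0 *.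
Qed.

Lemma gdotE (R : realType) (x u : 'rV[R]_2) :
  gdot x u u = u ord0 0 ^+ 2 + u ord0 1 ^+ 2
   - (x ord0 0 * u ord0 0 + x ord0 1 * u ord0 1) ^+ 2
     / (1 + (x ord0 0 ^+ 2 + x ord0 1 ^+ 2)).
Proof.
rewrite /gdot !sum2 !mxE !sum2.
have s0 : 1 + (x ord0 0 ^+ 2 + x ord0 1 ^+ 2) != 0.
  by rewrite -(sum2 (fun i => x ord0 i ^+ 2)) gt_eqF // sum_sq_gt0.
rewrite ?eqxx ?[(1 == 0 :> 'I_2)]eqE ?[(0 == 1 :> 'I_2)]eqE /=.
by field; rewrite ?addrA // in s0 *.
Qed.

Lemma cosh2_sinh2 (R : realType) (r : R) : cosh r ^+ 2 = 1 + sinh r ^+ 2.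
Proof.
have := expRxMexpNx_1 r; rewrite /cosh /sinh.
move: (expR r) (expR (-r)) => a b h.
have -> : 1 + ((a - b) / 2) ^+ 2 = a * b + ((a - b) / 2) ^+ 2 by rewrite h.
by field.
Qed.

Lemma cosh_gt0 (R : realType) (r : R) : 0 < cosh r.
Proof. by rewrite divr_gt0 // addr_gt0 // expR_gt0. Qed.

Lemma vec2_0 (R : realType) (a b : R) : vec2 a b ord0 0 = a.
Proof. by rewrite mxE. Qed.
Lemma vec2_1 (R : realType) (a b : R) : vec2 a b ord0 1 = b.
Proof. by rewrite mxE. Qed.

(* In polar coordinates the metric is dr ^ 2 + sinh ^ 2 r dtheta ^ 2. *)
Lemma polar_metric (R : realType) (r theta a b : R) :
  gdot (polar r theta) (polar_frame r theta a b).2 (polar_frame r theta a b).2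
  = a ^+ 2 + sinh r ^+ 2 * b ^+ 2.
Proof.
rewrite gdotE /= !vec2_0 !vec2_1.
have := cosh_gt0 r; have := cosh2_sinh2 r; have := cos2Dsin2 theta.
move: (cosh r) (sinh r) (cos theta) (sin theta) => c s co si h1 h2 h0.
have c0 : c != 0 by rewrite gt_eqF.
have -> : 1 + ((s * co) ^+ 2 + (s * si) ^+ 2) = c ^+ 2.
  by rewrite h2 -[s ^+ 2 in RHS]mulr1 -h1; ring.
have -> : s * co * (a * (c * co) - b * (s * si)) +
   s * si * (a * (c * si) + b * (s * co)) = a * s * c * (co ^+ 2 + si ^+ 2) by ring.
have -> : (a * (c * co) - b * (s * si)) ^+ 2 +
  (a * (c * si) + b * (s * co)) ^+ 2 = (a ^+ 2 * c ^+ 2 + b ^+ 2 * s ^+ 2) * (co ^+ 2 + si ^+ 2) by ring.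
rewrite h1 !mulr1.
have -> : (a * s * c) ^+ 2 / c ^+ 2 = (a * s) ^+ 2 by field.
by rewrite h2; ring.
Qed.

Lemma is_derive_scale (R : realType) (V : normedModType R) (e : V) (f : R -> R) (x d : R) :
  is_derive x 1 f d -> is_derive x 1 (fun s => f s *: e) (d *: e).
Proof.
move=> [f1 f2].
suff H : h^-1 *: (f (h *: 1 + x) *: e - f x *: e) @[h --> (0:R)^'] --> d *: e.
  by split; [apply: cvgP H | exact: (cvg_lim _ H)].
rewrite -f2.
have E : (fun h : R => (h^-1 *: (f (h *: 1 + x) - f x)) *: e) =
         (fun h => h^-1 *: (f (h *: 1 + x) *: e - f x *: e)).
  by apply/funext => h; rewrite -scalerA scalerBl.
rewrite -E; apply: cvgZl; exact: f1.
Qed.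

Lemma is_derive_TH2 (R : realType) (A B C D : R -> R) (x a b c d : R) :
  is_derive x 1 A a -> is_derive x 1 B b -> is_derive x 1 C c -> is_derive x 1 D d ->
  is_derive x 1 (fun s => (vec2 (A s) (B s), vec2 (C s) (D s)) : TH2 R) (vec2 a b, vec2 c d).
Proof.
move=> hA hB hC hD.
have E u v w z : (vec2 u v, vec2 w z) = u *: (vec2 1 0, 0) + v *: (vec2 0 1, 0)
    + (w *: (0, vec2 1 0) + z *: (0, vec2 0 1)) :> TH2 R.
  congr (_, _); apply/rowP => i; rewrite !mxE; case: ifP => _ /=; ring.
rewrite E (_ : (fun s => _) = (fun s => A s *: ((vec2 1 0, 0) : TH2 R))
  + (fun s => B s *: ((vec2 0 1, 0) : TH2 R)) + ((fun s => C s *: ((0, vec2 1 0) : TH2 R))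
  + (fun s => D s *: ((0, vec2 0 1) : TH2 R)))); last by apply/funext => s; rewrite E.
by apply: is_deriveD; apply: is_deriveD; apply: is_derive_scale.
Qed.

Lemma is_derive_sinh (R : realType) (x : R) : is_derive x 1 (@sinh R) (cosh x).
Proof.
have H : is_derive x 1 (fun s : R => expR (- s)) (- expR (- x)).
  have := @is_derive1_comp R expR -%R x (expR (- x)) (-1) _ _.
  by rewrite mulrN1; apply.
have := is_deriveM_fun (is_deriveD_fun (is_derive_expR x) (is_deriveN_fun H)) (is_deriveC_fun x 1 (2^-1 : R)).
by move=> h; apply: (is_derive_eq h); rewrite /cosh; ring.
Qed.

Lemma is_derive_cosh (R : realType) (x : R) : is_derive x 1 (@cosh R) (sinh x).
Proof.
have H : is_derive x 1 (fun s : R => expR (- s)) (- expR (- x)).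
  have := @is_derive1_comp R expR -%R x (expR (- x)) (-1) _ _.
  by rewrite mulrN1; apply.
have := is_deriveM_fun (is_deriveD_fun (is_derive_expR x) H) (is_deriveC_fun x 1 (2^-1 : R)).
by move=> h; apply: (is_derive_eq h); rewrite /sinh; ring.
Qed.

Lemma GammaE (R : realType) (x u v : 'rV[R]_2) : Gamma x u v = - gdot x u v *: x.
Proof.
apply/rowP => k; rewrite !mxE /gdot !sum2 !christoffelE; ring.
Qed.

(* In polar coordinates X = v^r d/dr + v^theta d/dtheta
     + (v^theta) ^ 2 sinh r cosh r d/dv^r - 2 v^r v^theta coth r d/dv^theta. *)
Lemma polar_geodesic_field (R : realType) (r theta a b : R) : 0 < r ->
  geodesic_field (polar_frame r theta a b) =
    a *: derive1 (fun s => polar_frame s theta a b) r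
    + b *: derive1 (fun s => polar_frame r s a b) theta
    + (b ^+ 2 * sinh r * cosh r) *: derive1 (fun s => polar_frame r theta s b) a
    - (2 * a * b * (cosh r / sinh r)) *: derive1 (fun s => polar_frame r theta a s) b.
Proof.
move=> r0.
have s0 : sinh r != 0.
  by rewrite gt_eqF // divr_gt0 // subr_gt0 ltr_expR; lra.
have I (x : R) : is_derive x 1 (id : R -> R) 1 by exact: is_derive_id.
pose cst' (x c : R) := is_deriveC_fun x (1 : R) c.
have Sh (x : R) : is_derive x 1 (@sinh R) (cosh x) by exact: is_derive_sinh.
have Ch (x : R) : is_derive x 1 (@cosh R) (sinh x) by exact: is_derive_cosh.
have Sn (x : R) : is_derive x 1 (@sin R) (cos x) by exact: is_derive_sin.
have Cn (x : R) : is_derive x 1 (@cos R) (- sin x) by exact: is_derive_cos.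
rewrite !derive1E /polar_frame /polar.
have [_ ->] := is_derive_TH2 (is_deriveM_fun (Sh r) (cst' r (cos theta))) (is_deriveM_fun (Sh r) (cst' r (sin theta)))
  (is_deriveD_fun (is_deriveM_fun (cst' r a) (is_deriveM_fun (Ch r) (cst' r (cos theta)))) (is_deriveN_fun (is_deriveM_fun (cst' r b) (is_deriveM_fun (Sh r) (cst' r (sin theta))))))
  (is_deriveD_fun (is_deriveM_fun (cst' r a) (is_deriveM_fun (Ch r) (cst' r (sin theta)))) (is_deriveM_fun (cst' r b) (is_deriveM_fun (Sh r) (cst' r (cos theta))))).
have [_ ->] := is_derive_TH2 (is_deriveM_fun (cst' theta (sinh r)) (Cn theta)) (is_deriveM_fun (cst' theta (sinh r)) (Sn theta))
  (is_deriveD_fun (is_deriveM_fun (cst' theta a) (is_deriveM_fun (cst' theta (cosh r)) (Cn theta))) (is_deriveN_fun (is_deriveM_fun (cst' theta b) (is_deriveM_fun (cst' theta (sinh r)) (Sn theta)))))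
  (is_deriveD_fun (is_deriveM_fun (cst' theta a) (is_deriveM_fun (cst' theta (cosh r)) (Sn theta))) (is_deriveM_fun (cst' theta b) (is_deriveM_fun (cst' theta (sinh r)) (Cn theta)))).
have [_ ->] := is_derive_TH2 (cst' a (sinh r * cos theta)) (cst' a (sinh r * sin theta))
  (is_deriveD_fun (is_deriveM_fun (I a) (cst' a (cosh r * cos theta))) (cst' a (- (b * (sinh r * sin theta)))))
  (is_deriveD_fun (is_deriveM_fun (I a) (cst' a (cosh r * sin theta))) (cst' a (b * (sinh r * cos theta)))).
have [_ ->] := is_derive_TH2 (cst' b (sinh r * cos theta)) (cst' b (sinh r * sin theta))
  (is_deriveD_fun (cst' b (a * (cosh r * cos theta))) (is_deriveN_fun (is_deriveM_fun (I b) (cst' b (sinh r * sin theta)))))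
  (is_deriveD_fun (cst' b (a * (cosh r * sin theta))) (is_deriveM_fun (I b) (cst' b (sinh r * cos theta)))).
rewrite /geodesic_field GammaE (polar_metric r theta a b).
have -> : sinh r ^+ 2 = cosh r ^+ 2 - 1 by rewrite cosh2_sinh2 addrC addKr.
have E : forall i : 'I_2, i = 0 \/ i = 1.
  by case=> [[|[|//]]] Hi; [left|right]; apply/val_inj.
move: (cosh r) (sinh r) s0 => c s s0.
congr (_, _); apply/rowP => i; case: (E i) => ->; rewrite !mxE /=; field => //.
Qed.

(* Main.v *)
Require Import Defs.
From mathcomp Require Import all_boot all_order all_algebra.
From mathcomp Require Import all_classical all_reals all_analysis.
From mathcomp Require Import measurable_realfun.
From mathcomp Require Import ring lra.
Import Order.TTheory GRing.Theory Num.Theory.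
Import numFieldNormedType.Exports.

Local Open Scope classical_set_scope.
Local Open Scope ring_scope.

(** The solution at time [t] is [f0] composed with the geodesic flow at time
[- t] ([vlasov_transport]), so the density at [x] integrates [f0] over the
velocities whose backward geodesic from [x] lands in the support of [f0], that
is, in a fixed ball about the origin.

The set of these velocities is small because the exponential map of a space of
nonpositive curvature does not contract distances: comparing the hyperbolic law
of cosines with the Euclidean one ([law_of_cosines_le], [flow_support]) shows
that the set lies in a ball of radius [O(1 / t)] of the tangent plane, whose
area is [O(1 / t ^ 2)] ([fibre_integral_le]).  This is the bound on the density.

Differentiating the flow itself would produce Jacobi fields that grow
exponentially.  They are avoided by differentiating along Killing fields: a
boost of the hyperboloid in a direction [e] is an isometry, so it commutes with
the geodesic flow ([flow_boost]) and preserves the volume of the fibres.  Hence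
the derivative of the density along the boost is the integral over the fibre of
the derivative of [f0] along the lifted boost field, taken at the endpoint of
the backward geodesic ([derive_boost_transport]).  That endpoint ranges over the
compact support, where the lifted field is bounded ([sasaki_boost_field]), and
the area bound applies once more.  In the hyperboloid chart the value at [x] of
the boost field in direction [e] is [height x *: e], so the boosts span every
tangent plane and their derivatives control both vectors of the polar frame;
they are [O(1 / t ^ 2)], hence [O(1 / t)] for [t >= 1].

The infinitesimal form of the invariance of the density under boosts is
[is_derive_density]: differentiate under the integral sign, then integrate by
parts in the fibre to absorb the derivative of the volume density. *)

(** * Hyperbolic functions *)

Section hyperbolic_functions.
Context {R : realType}.
Implicit Types r s T D : R.

Lemma sinh0 : sinh (0 : R) = 0.
Proof. by rewrite /sinh oppr0 subrr mul0r. Qed.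

Lemma cosh0 : cosh (0 : R) = 1.
Proof. by rewrite /cosh oppr0 expR0; lra. Qed.

Lemma coshN r : cosh (- r) = cosh r.
Proof. by rewrite /cosh opprK addrC. Qed.

Lemma sinhN r : sinh (- r) = - sinh r.
Proof. by rewrite /sinh opprK -mulNr opprB. Qed.

Lemma coshB T D : cosh (T - D) = cosh T * cosh D - sinh T * sinh D.
Proof. by rewrite /cosh /sinh opprB !expRD; field. Qed.

Lemma sinh_ge_id r : 0 <= r -> r <= sinh r.
Proof.
move=> r0; rewrite -subr_ge0.
have D s : is_derive s (1 : R) (fun z => sinh z - z) (cosh s - 1).
  by apply: is_deriveB; exact: is_derive_sinh.
rewrite -[leLHS](_ : sinh 0 - 0 = 0); last by rewrite sinh0 subrr.
apply: (@ger0_derive1_le_cc R (fun z => sinh z - z) 0 r) => //.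
- move=> s _; rewrite derive1E; have [_ ->] := D s; rewrite subr_ge0.
  rewrite -(@ler_pXn2r _ 2) ?nnegrE ?(ltW (cosh_gt0 _))// cosh2_sinh2 expr1n.
  by rewrite lerDl sqr_ge0.
- apply: continuous_subspaceT => s; apply: differentiable_continuous.
  by apply/derivable1_diffP; case: (D s).
- by rewrite in_itv /= lexx.
- by rewrite in_itv /= r0 lexx.
Qed.

Lemma sqr_le_cosh r : r ^+ 2 <= 2 * (cosh r - 1).
Proof.
wlog r0 : r / 0 <= r.
  move=> H; case: (leP 0 r) => [/H//|/ltW r0].
  by rewrite -sqrrN -coshN H // oppr_ge0.
have -> : cosh r = 1 + 2 * sinh (r / 2) ^+ 2.
  have -> : cosh r = cosh (r / 2 - (- (r / 2))) by congr cosh; lra.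
  by rewrite coshB coshN sinhN mulrN opprK -!expr2 cosh2_sinh2; lra.
have h : r / 2 <= sinh (r / 2) by apply: sinh_ge_id; lra.
have : (r / 2) ^+ 2 <= sinh (r / 2) ^+ 2 by rewrite ler_pXn2r// nnegrE; lra.
lra.
Qed.

(** Any point [(h, n)] of the unit hyperbola has a hyperbolic angle, namely
[ln (n + h)]. *)
Lemma arsinh_ex (n h : R) : 0 <= n -> 0 < h -> h ^+ 2 = 1 + n ^+ 2 ->
  exists D, [/\ 0 <= D, sinh D = n & cosh D = h].
Proof.
move=> n0 h0 hn.
have h1 : 1 <= h by rewrite -(@ler_pXn2r _ 2) ?nnegrE ?(ltW h0)// hn expr1n lerDl sqr_ge0.
have p0 : 0 < n + h by lra.
have E : expR (ln (n + h)) = n + h by rewrite lnK.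
have E' : expR (- ln (n + h)) = h - n.
  rewrite expRN E; apply: (mulfI (lt0r_neq0 p0)); rewrite divff ?gt_eqF//.
  have -> : (n + h) * (h - n) = h ^+ 2 - n ^+ 2 by ring.
  by rewrite hn addrK.
exists (ln (n + h)); split.
- by rewrite ln_ge0//; lra.
- by rewrite /sinh E E'; lra.
- by rewrite /cosh E E'; lra.
Qed.

(** Take triangles with two sides [T], [D] enclosing an angle of cosine [c].  The
left side is the squared third side of the Euclidean triangle, and the right side
is [2 (cosh d - 1)] for the third side [d] of the hyperbolic one.  The term
[(T - D) ^ 2] is compared by [sqr_le_cosh] and the remainder [2 T D (1 - c)] by
[sinh_ge_id]. *)
Lemma law_of_cosines_le T D (c : R) : 0 <= T -> 0 <= D -> c <= 1 ->
  T ^+ 2 + D ^+ 2 - 2 * (T * D * c)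
    <= 2 * (cosh T * cosh D - sinh T * sinh D * c - 1).
Proof.
move=> T0 D0 c1.
have h1 := sqr_le_cosh (T - D); rewrite coshB in h1.
have h2 : T * D <= sinh T * sinh D by apply: ler_pM => //; exact: sinh_ge_id.
have h3 : 0 <= (sinh T * sinh D - T * D) * (1 - c) by rewrite mulr_ge0; lra.
lra.
Qed.

End hyperbolic_functions.

(** * The hyperboloid, its geodesic flow and its boosts *)

Lemma sqr_lt_add_gt0 {R : realDomainType} (a b : R) :
  0 <= b -> a ^+ 2 < b ^+ 2 -> 0 < b + a.
Proof.
move=> b0; apply: contraTT; rewrite -!leNgt -[_ + _]opprK opprD oppr_le0 addrC.
rewrite subr_ge0 => ba; rewrite -[a ^+ 2]sqrrN ler_pXn2r ?nnegrE//.
exact: le_trans ba.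
Qed.

Section hyperboloid.
Context {R : realType}.
Implicit Types (x u v e : 'rV[R]_2) (p : TH2 R).

Definition dot u v : R := u ord0 0 * v ord0 0 + u ord0 1 * v ord0 1.

(** The time coordinate of the point of the hyperboloid over [x]. *)
Definition height x : R := Num.sqrt (1 + dot x x).

(** The time coordinate of the vector tangent to the hyperboloid at [x] whose
spatial part is [v]. *)
Definition tcomp x v : R := dot x v / height x.

Lemma dotC u v : dot u v = dot v u.
Proof. by rewrite /dot; ring. Qed.

Lemma dotDl u1 u2 v : dot (u1 + u2) v = dot u1 v + dot u2 v.
Proof. by rewrite /dot !mxE; ring. Qed.

Lemma dotZl (c : R) u v : dot (c *: u) v = c * dot u v.
Proof. by rewrite /dot !mxE; ring. Qed.

Lemma dotDr u1 u2 v : dot v (u1 + u2) = dot v u1 + dot v u2.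
Proof. by rewrite dotC dotDl !(dotC v). Qed.

Lemma dotZr (c : R) u v : dot v (c *: u) = c * dot v u.
Proof. by rewrite dotC dotZl (dotC v). Qed.

Lemma dot_ge0 u : 0 <= dot u u.
Proof. by rewrite /dot -!expr2 addr_ge0// sqr_ge0. Qed.

Lemma dot_eq0 u : dot u u = 0 -> u = 0.
Proof.
move=> /eqP; rewrite /dot -!expr2 paddr_eq0 ?sqr_ge0// !sqrf_eq0.
case/andP => /eqP u0 /eqP u1; apply/rowP => i; rewrite mxE.
by case: i => [[|[|//]]] i; [rewrite -u0|rewrite -u1]; congr (u _ _); apply/val_inj.
Qed.

Lemma dot_CS u v : dot u v ^+ 2 <= dot u u * dot v v.
Proof.
rewrite -subr_ge0; set D := _ - _.
have -> : D = (u ord0 0 * v ord0 1 - u ord0 1 * v ord0 0) ^+ 2.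
  by rewrite /D /dot; ring.
exact: sqr_ge0.
Qed.

Lemma height_gt0 x : 0 < height x.
Proof. by rewrite sqrtr_gt0 ltr_pwDl// dot_ge0. Qed.

Lemma height_sqr x : height x ^+ 2 = 1 + dot x x.
Proof. by rewrite sqr_sqrtr// addr_ge0// dot_ge0. Qed.

Lemma height_ge1 x : 1 <= height x.
Proof.
rewrite -(@ler_pXn2r _ 2) ?nnegrE ?(ltW (height_gt0 _))// height_sqr expr1n.
by rewrite lerDl dot_ge0.
Qed.

Lemma height_tcomp x v : height x * tcomp x v = dot x v.
Proof. by rewrite /tcomp mulrC mulfVK// gt_eqF// height_gt0. Qed.

Lemma heightE x (h : R) : 0 < h -> h ^+ 2 = 1 + dot x x -> height x = h.
Proof. by move=> h0 hx; rewrite /height -hx sqrtr_sqr gtr0_norm. Qed.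

Lemma tcompE x v (k : R) : height x * k = dot x v -> tcomp x v = k.
Proof. by move=> E; rewrite /tcomp -E mulrC mulKf// gt_eqF// height_gt0. Qed.

(** The metric is induced by the Lorentzian form of the ambient space. *)
Lemma gdot_dot x u v : gdot x u v = dot u v - tcomp x u * tcomp x v.
Proof.
have -> : tcomp x u * tcomp x v = dot x u * dot x v / height x ^+ 2.
  by rewrite /tcomp; field; rewrite gt_eqF// height_gt0.
rewrite height_sqr /gdot !sum2 !mxE !sum2 /dot.
have s0 : 1 + (x ord0 0 ^+ 2 + x ord0 1 ^+ 2) != 0.
  by rewrite -(sum2 (fun i => x ord0 i ^+ 2)) gt_eqF // sum_sq_gt0.
rewrite ?eqxx ?[(1 == 0 :> 'I_2)]eqE ?[(0 == 1 :> 'I_2)]eqE /= -?expr2.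
by field; rewrite ?addrA // in s0 *.
Qed.

(** The smallest eigenvalue of the metric is [(height x) ^- 2], in the radial
direction. *)
Lemma dot_le_gdot x v : dot v v <= height x ^+ 2 * gdot x v v.
Proof.
rewrite gdot_dot mulrBr -!expr2 -exprMn height_tcomp.
have := dot_CS x v; rewrite height_sqr; lra.
Qed.

Lemma gdot_ge0 x v : 0 <= gdot x v v.
Proof.
have := le_trans (dot_ge0 v) (dot_le_gdot x v).
by rewrite pmulr_rge0// exprn_gt0// height_gt0.
Qed.

(** Cauchy-Schwarz against the radial vector, read off the time component. *)
Lemma tcomp_CS x v : tcomp x v ^+ 2 <= dot x x * gdot x v v.
Proof.
have := dot_le_gdot x v; rewrite height_sqr.
by rewrite {1}(_ : dot v v = gdot x v v + tcomp x v ^+ 2) ?gdot_dot -?expr2 ?subrK//; lra.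
Qed.

Definition speed p : R := Num.sqrt (gdot p.1 p.2 p.2).

Lemma speed_ge0 p : 0 <= speed p.
Proof. exact: sqrtr_ge0. Qed.

Lemma speed_sqr p : speed p ^+ 2 = gdot p.1 p.2 p.2.
Proof. by rewrite sqr_sqrtr// gdot_ge0. Qed.

Lemma speed0 p : speed p = 0 -> p.2 = 0.
Proof.
move=> w0; apply: dot_eq0; apply: le_anti; rewrite dot_ge0 andbT.
by rewrite (le_trans (dot_le_gdot p.1 p.2))// -speed_sqr w0 expr0n mulr0.
Qed.

Lemma geodesic_fieldE p : geodesic_field p = (p.2, speed p ^+ 2 *: p.1).
Proof. by rewrite /geodesic_field GammaE scaleNr opprK speed_sqr. Qed.

(** Lift [p] to a point [X] of the hyperboloid and a tangent vector [W] in the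
ambient Lorentzian space.  As [X] and [W] are orthogonal, of squares [1] and
[- w2], the pair [(C X + S W, C W + S w2 X)] with [C ^ 2 - S ^ 2 w2 = 1] is again
a point and a tangent vector of the same length.  The three identities are this
fact in the chart; the bound [kh] keeps the new point on the upper sheet. *)
Lemma hyperboloid_combo p (C S : R) : 0 < C -> C ^+ 2 - S ^+ 2 * speed p ^+ 2 = 1 ->
  let h := height p.1 in let k := tcomp p.1 p.2 in let w2 := speed p ^+ 2 in
  let y := C *: p.1 + S *: p.2 in let z := C *: p.2 + (S * w2) *: p.1 in
  [/\ height y = C * h + S * k, tcomp y z = C * k + S * w2 * h
    & gdot y z z = w2].
Proof.
move=> C0 CS h k w2 y z.
have hk : h * k = dot p.1 p.2 := height_tcomp _ _.
have hh : h ^+ 2 = 1 + dot p.1 p.1 := height_sqr _.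
have ww : w2 = dot p.2 p.2 - k ^+ 2 by rewrite /w2 speed_sqr gdot_dot expr2.
have h0 : 0 < h := height_gt0 _.
have kh : k ^+ 2 <= (h ^+ 2 - 1) * w2.
  by rewrite hh addrC addKr /w2 speed_sqr tcomp_CS.
have pos : 0 < C * h + S * k.
  apply: sqr_lt_add_gt0; first by rewrite mulr_ge0// ltW.
  have H1 : S ^+ 2 * k ^+ 2 <= S ^+ 2 * ((h ^+ 2 - 1) * w2).
      by rewrite ler_wpM2l// sqr_ge0.
  have H2 : S ^+ 2 * ((h ^+ 2 - 1) * w2) = (C ^+ 2 - 1) * (h ^+ 2 - 1).
    by rewrite -CS /w2; ring.
  have h1 : 1 <= h ^+ 2 by rewrite hh lerDl dot_ge0.
  have C2 : 0 < C ^+ 2 by rewrite exprn_gt0.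
  rewrite (exprMn _ S) (exprMn _ C) (le_lt_trans H1)// H2; lra.
have hy : height y = C * h + S * k.
  apply: heightE => //; rewrite /y !(dotDl, dotDr, dotZl, dotZr) (dotC p.2 p.1).
  rewrite -hk; have -> : dot p.1 p.1 = h ^+ 2 - 1 by rewrite hh; ring.
  have -> : dot p.2 p.2 = w2 + k ^+ 2 by rewrite ww; ring.
  transitivity ((C * h + S * k) ^+ 2 + (1 - (C ^+ 2 - S ^+ 2 * w2))); last by ring.
  by rewrite CS subrr addr0.
have hz : tcomp y z = C * k + S * w2 * h.
  apply: tcompE; rewrite hy /y /z !(dotDl, dotDr, dotZl, dotZr) (dotC p.2 p.1).
  rewrite -hk; have -> : dot p.1 p.1 = h ^+ 2 - 1 by rewrite hh; ring.
  have -> : dot p.2 p.2 = w2 + k ^+ 2 by rewrite ww; ring.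
  by ring.
split=> //; rewrite gdot_dot hz /z !(dotDl, dotDr, dotZl, dotZr) (dotC p.2 p.1).
rewrite -hk; have -> : dot p.1 p.1 = h ^+ 2 - 1 by rewrite hh; ring.
have -> : dot p.2 p.2 = w2 + k ^+ 2 by rewrite ww; ring.
transitivity (w2 * (C ^+ 2 - S ^+ 2 * w2)); first by ring.
by rewrite CS mulr1.
Qed.

(** The geodesic flow, explicitly: a geodesic of the hyperboloid is its
intersection with a plane through the origin.  When the speed [w] vanishes so
does the geodesic field at [p], and the value [0] of [sinh (w * s) / w] in that
case is harmless. *)
Definition flow (s : R) p : TH2 R :=
  cosh (speed p * s) *: p + (sinh (speed p * s) / speed p) *: geodesic_field p.

Lemma flow0 p : flow 0 p = p.
Proof. by rewrite /flow mulr0 cosh0 sinh0 mul0r scale0r scale1r addr0. Qed.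

Lemma flow_coefE p (s : R) :
  cosh (speed p * s) ^+ 2
    - (sinh (speed p * s) / speed p) ^+ 2 * speed p ^+ 2 = 1.
Proof.
rewrite cosh2_sinh2 -exprMn; have [->|w0] := eqVneq (speed p) 0.
  by rewrite mul0r sinh0 !mul0r expr0n /=; lra.
by rewrite mulfVK//; ring.
Qed.

Lemma flowE s p : flow s p =
  (cosh (speed p * s) *: p.1 + (sinh (speed p * s) / speed p) *: p.2,
   cosh (speed p * s) *: p.2
     + (sinh (speed p * s) / speed p * speed p ^+ 2) *: p.1).
Proof.
by rewrite /flow geodesic_fieldE -(scalerA _ (speed p ^+ 2)).
Qed.

Lemma flow_facts s p :
  let h := height p.1 in let k := tcomp p.1 p.2 in
  let C := cosh (speed p * s) in let S := sinh (speed p * s) / speed p in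
  [/\ height (flow s p).1 = C * h + S * k,
      tcomp (flow s p).1 (flow s p).2 = C * k + S * speed p ^+ 2 * h
    & speed (flow s p) = speed p].
Proof.
move=> h k C S.
have [] := @hyperboloid_combo p C S (cosh_gt0 _) (flow_coefE _ _).
rewrite flowE /= => H1 H2 H3; split=> //.
by rewrite [LHS]/speed /= H3 sqrtr_sqr ger0_norm// speed_ge0.
Qed.

Lemma is_derive_flow (s : R) p :
  is_derive s (1 : R) (fun z => flow z p) (geodesic_field (flow s p)).
Proof.
set w := speed p.
have W : is_derive s (1 : R) (fun z : R => w * z) w.
  have := is_deriveM_fun (is_deriveC_fun s (1 : R) w) (is_derive_id s (1 : R)).
  by move=> H; apply: (is_derive_eq H); ring.
have Ch : is_derive s (1 : R) (fun z => cosh (w * z)) (w * sinh (w * s)).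
  have := @is_derive1_comp R (@cosh R) (fun z => w * z) s _ _ (is_derive_cosh _) W.
  by rewrite mulrC.
have Sh : is_derive s (1 : R) (fun z => sinh (w * z) / w) (w * cosh (w * s) / w).
  have H : is_derive s (1 : R) (fun z => sinh (w * z)) (w * cosh (w * s)).
    have := @is_derive1_comp R (@sinh R) (fun z => w * z) s _ _ (is_derive_sinh _) W.
    by rewrite mulrC.
  have := is_deriveM_fun H (is_deriveC_fun s (1 : R) (w^-1)).
  by move=> H'; apply: (is_derive_eq H'); ring.
have := is_deriveD (is_derive_scale p Ch) (is_derive_scale (geodesic_field p) Sh).
move=> H; apply: (is_derive_eq H).
rewrite [RHS]geodesic_fieldE; have [_ _ ->] := flow_facts s p.
rewrite !geodesic_fieldE flowE -/w /=.
have [w0|w0] := eqVneq w 0.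
  have -> : p.2 = 0 := speed0 _ w0.
  by rewrite w0 invr0 !(mul0r, mulr0, expr0n, scale0r, scaler0, addr0).
rewrite (_ : w * cosh (w * s) / w = cosh (w * s)); last by field.
rewrite (_ : sinh (w * s) / w * w ^+ 2 = w * sinh (w * s)); last by field.
congr (_, _); apply/rowP => i; rewrite !mxE /=; first by rewrite addrC.
by field.
Qed.

(** The complete lift to the tangent bundle of the Killing field of the
boosts in direction [e]. *)
Definition boost_field e p : TH2 R :=
  (height p.1 *: e, tcomp p.1 p.2 *: e).

(** The boost of rapidity [s] in the unit direction [e], an isometry of the
hyperbolic plane lifted to its tangent bundle. *)
Definition boost e (s : R) p : TH2 R :=
  p + (cosh s - 1) *: ((dot p.1 e *: e, dot p.2 e *: e) : TH2 R)
    + sinh s *: boost_field e p.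

Lemma boostE e s p : boost e s p =
  (p.1 + ((cosh s - 1) * dot p.1 e + sinh s * height p.1) *: e,
   p.2 + ((cosh s - 1) * dot p.2 e + sinh s * tcomp p.1 p.2) *: e).
Proof.
by rewrite /boost /boost_field; congr (_, _); rewrite /= scalerDl -!scalerA addrA.
Qed.

Lemma is_derive_boost e p :
  is_derive (0 : R) (1 : R) (fun s => boost e s p) (boost_field e p).
Proof.
have H1 : is_derive (0 : R) (1 : R) (fun s => cosh s - 1) (0 : R).
  have := is_deriveB (is_derive_cosh (0 : R)) (is_deriveC_fun (0 : R) (1 : R) (1 : R)).
  by move=> H; apply: (is_derive_eq H); rewrite sinh0 subr0.
have H2 := is_derive_sinh (0 : R).
have := is_deriveD (is_deriveD (is_derive_cst p (0 : R) (1 : R))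
   (is_derive_scale ((dot p.1 e *: e, dot p.2 e *: e) : TH2 R) H1))
   (is_derive_scale (boost_field e p) H2).
by move=> H; apply: (is_derive_eq H); rewrite cosh0 scale1r scale0r !add0r.
Qed.

Lemma boost0 e p : boost e 0 p = p.
Proof. by rewrite /boost cosh0 subrr scale0r sinh0 scale0r !addr0. Qed.

Lemma boost_facts e s p : dot e e = 1 ->
  [/\ height (boost e s p).1 = cosh s * height p.1 + sinh s * dot p.1 e,
      tcomp (boost e s p).1 (boost e s p).2
        = cosh s * tcomp p.1 p.2 + sinh s * dot p.2 e
    & speed (boost e s p) = speed p].
Proof.
move=> e1; rewrite boostE /=.
set h := height p.1; set k := tcomp p.1 p.2; set C := cosh s; set S := sinh s.
have hk : h * k = dot p.1 p.2 := height_tcomp _ _.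
have hh : h ^+ 2 = 1 + dot p.1 p.1 := height_sqr _.
have ww : speed p ^+ 2 = dot p.2 p.2 - k ^+ 2 by rewrite speed_sqr gdot_dot expr2.
have h0 : 0 < h := height_gt0 _.
have CS : C ^+ 2 = 1 + S ^+ 2 := cosh2_sinh2 _.
have C0 : 0 < C := cosh_gt0 _.
have pos : 0 < C * h + S * dot p.1 e.
  apply: sqr_lt_add_gt0; first by rewrite mulr_ge0// ltW.
  have := dot_CS p.1 e; rewrite e1 mulr1.
  have -> : dot p.1 p.1 = h ^+ 2 - 1 by rewrite hh; ring.
  move=> H; have H1 := ler_wpM2l (sqr_ge0 S) H.
  have h1 : 1 <= h ^+ 2 by rewrite hh lerDl dot_ge0.
  have C2 := sqr_ge0 S.
  rewrite (exprMn _ S) (exprMn _ C) (le_lt_trans H1)// CS; lra.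
have hy : height (p.1 + ((C - 1) * dot p.1 e + S * h) *: e) = C * h + S * dot p.1 e.
  apply: heightE => //; rewrite !(dotDl, dotDr, dotZl, dotZr) (dotC e p.1) e1.
  have -> : dot p.1 p.1 = h ^+ 2 - 1 by rewrite hh; ring.
  have -> : (C * h + S * dot p.1 e) ^+ 2 =
    C ^+ 2 * h ^+ 2 + 2 * C * S * h * dot p.1 e + S ^+ 2 * dot p.1 e ^+ 2 by ring.
  transitivity (h ^+ 2 + (C ^+ 2 - 1) * dot p.1 e ^+ 2 + 2 * C * S * h * dot p.1 e + S ^+ 2 * h ^+ 2); last by ring.
  by rewrite CS; ring.
have hz : tcomp (p.1 + ((C - 1) * dot p.1 e + S * h) *: e)
   (p.2 + ((C - 1) * dot p.2 e + S * k) *: e) = C * k + S * dot p.2 e.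
  apply: tcompE; rewrite hy !(dotDl, dotDr, dotZl, dotZr) (dotC e p.2) e1 -hk.
  transitivity (h * k + (C ^+ 2 - 1) * (dot p.1 e * dot p.2 e)
    + C * S * (h * dot p.2 e + k * dot p.1 e) + S ^+ 2 * (h * k)); last by ring.
  transitivity (C ^+ 2 * (h * k) + S ^+ 2 * (dot p.1 e * dot p.2 e)
    + C * S * (h * dot p.2 e + k * dot p.1 e)); first by ring.
  by rewrite CS; ring.
split=> //.
rewrite /speed /=; congr Num.sqrt; rewrite -[RHS]speed_sqr ww gdot_dot hz.
rewrite !(dotDl, dotDr, dotZl, dotZr) (dotC e p.2) e1.
transitivity (dot p.2 p.2 + (C ^+ 2 - 1) * dot p.2 e ^+ 2 + S ^+ 2 * k ^+ 2
   - C ^+ 2 * k ^+ 2 - S ^+ 2 * dot p.2 e ^+ 2); first by ring.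
by rewrite CS; ring.
Qed.

(** Boosts act linearly on the ambient space and preserve the speed, while the
flow takes linear combinations with coefficients that depend on the speed. *)
Lemma flow_boost e s t p : dot e e = 1 ->
  flow t (boost e s p) = boost e s (flow t p).
Proof.
move=> e1; have [B1 B2 B3] := boost_facts e s p e1.
have [F1 F2 F3] := flow_facts t p.
rewrite [RHS]boostE F1 F2 [LHS]flowE B3 !flowE boostE /=.
rewrite !(dotDl, dotZl).
set C := cosh _; set S := sinh _ / _.
by congr (_, _); apply/rowP => i; rewrite !mxE; ring.
Qed.

End hyperboloid.

(** * Backward geodesics that reach a ball, and the volume of the fibres *)

Section support.
Context {R : realType}.
Implicit Types (x u v e : 'rV[R]_2) (p : TH2 R).

Lemma gdot_shift x v (c : R) :
  gdot x (v - c *: x) (v - c *: x) =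
    gdot x v v - 2 * c * tcomp x v / height x + c ^+ 2 * dot x x / height x ^+ 2.
Proof.
have h0 : height x != 0 by rewrite gt_eqF// height_gt0.
have hv := height_tcomp x v; have hx := height_tcomp x x.
have h2 := height_sqr x.
have xx : tcomp x x = dot x x / height x by [].
have tc : tcomp x (v - c *: x) = tcomp x v - c * (dot x x / height x).
  rewrite /tcomp (_ : dot x (v - c *: x) = dot x v - c * dot x x).
    by rewrite mulrBl mulrA.
  by rewrite -scaleNr dotDr dotZr mulNr.
rewrite !gdot_dot tc -scaleNr !(dotDl, dotDr, dotZl, dotZr) (dotC v x) -hv.
have -> : dot x x = height x ^+ 2 - 1 by rewrite h2; ring.
by field.
Qed.

(** The velocity [u] is the one that reaches the origin at time [- t]: it is
radial, of length [D / t] with [D] the distance to the origin.  Multiplied by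
[t ^ 2], the claim is the comparison of the two laws of cosines in the triangle
with vertices [x], the origin and the position at time [- t], whose sides at [x]
have lengths [w t] and [D]. *)
Lemma flow_support (t : R) x : 0 < t -> exists u, forall v,
  gdot x (v - u) (v - u) <= 2 * (height (flow (- t) (x, v)).1 - 1) / t ^+ 2.
Proof.
move=> t0; pose n := Num.sqrt (dot x x).
have n0 : 0 <= n by exact: sqrtr_ge0.
have n2 : n ^+ 2 = dot x x by rewrite sqr_sqrtr// dot_ge0.
pose h := height x.
have h0 : 0 < h := height_gt0 _.
have hn : h ^+ 2 = 1 + n ^+ 2 by rewrite n2 height_sqr.
have [D [D0 sD cD]] := arsinh_ex n h n0 h0 hn.
exists ((D / t * (h / n)) *: x) => v.
rewrite gdot_shift -n2; pose w := speed (x, v); pose k := tcomp x v.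
have [-> _ _] := flow_facts (- t) (x, v); rewrite /= -/w -/k -/h.
rewrite mulrN coshN sinhN mulNr -[gdot x v v](speed_sqr (x, v)) -/w.
have w0 : 0 <= w := speed_ge0 _.
have kn : k ^+ 2 <= n ^+ 2 * w ^+ 2.
  by rewrite n2 /w speed_sqr; exact: tcomp_CS.
clearbody k w.
have wt0 : 0 <= w * t by rewrite mulr_ge0// ltW.
rewrite ler_pdivlMr ?exprn_gt0//.
(* At the origin the radial direction degenerates, and [u = 0]. *)
have [nE|n_neq0] := eqVneq n 0.
  have hE : h = 1.
    apply/eqP; rewrite -(@eqrXn2 _ 2) ?ltW// ?ltr01//.
    by rewrite hn nE expr0n addr0 expr1n.
  have kE : k = 0.
    apply/eqP; rewrite -sqrf_eq0; apply/eqP/le_anti.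
    by rewrite sqr_ge0 andbT (le_trans kn)// nE expr0n mul0r.
  rewrite kE nE hE invr0 expr0n /= !(mulr0, mul0r, subr0, addr0, mulr1).
  by rewrite -exprMn; exact: sqr_le_cosh.
(* The cosine of the angle at [x]; it is [0] when the speed vanishes. *)
pose c := k / (n * w).
have np : 0 < n by rewrite lt_def n_neq0 n0.
have wE : w = 0 -> k = 0.
  move=> wE; apply/eqP; rewrite -sqrf_eq0; apply/eqP/le_anti.
  by rewrite sqr_ge0 andbT (le_trans kn)// wE expr0n mulr0.
have c1 : c <= 1.
  have [/wE kE|w_neq0] := eqVneq w 0; first by rewrite /c kE mul0r ler01.
  have wp : 0 < w by rewrite lt_def w_neq0 w0.
  rewrite /c ler_pdivrMr ?mulr_gt0// mul1r.
  have [k0|k0] := ltP k 0; first by rewrite (le_trans (ltW k0))// mulr_ge0.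
  by rewrite -(@ler_pXn2r _ 2) ?nnegrE ?(mulr_ge0 n0 w0)// exprMn.
have := law_of_cosines_le (w * t) D c wt0 D0 c1; rewrite sD cD.
have -> : w * t * D * c = t * D * k / n.
  rewrite /c; have [/[dup] /wE -> ->|w_neq0] := eqVneq w 0.
    by rewrite !(mul0r, mulr0).
  by field; rewrite n_neq0.
have -> : sinh (w * t) * n * c = sinh (w * t) / w * k.
  rewrite /c invfM; move: w^-1 => iw; by field.
set Q := (X in _ <= X -> _); set Q' := (X in _ -> _ <= X).
have -> : Q' = Q by rewrite /Q' /Q; ring.
congr (_ <= _); field.
by rewrite n_neq0 (gt_eqF h0) (gt_eqF t0).
Qed.

(** Completing the square: a ball of the metric at [x] lies in a parallelogram
with one side parallel to an axis. *)
Lemma gdot_ball_parallelogram x u (r : R) : 0 <= r -> gdot x u u <= r ^+ 2 ->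
  let a := Num.sqrt (1 + x ord0 1 ^+ 2) in
  `|u ord0 1| <= r * a /\
  `|u ord0 0 - x ord0 0 * x ord0 1 / a ^+ 2 * u ord0 1| <= r * (height x / a).
Proof.
move=> r0 ur a.
have a2 : a ^+ 2 = 1 + x ord0 1 ^+ 2.
  by rewrite sqr_sqrtr// addr_ge0// sqr_ge0.
have a0 : 0 < a by rewrite sqrtr_gt0 ltr_pwDl// sqr_ge0.
have h0 := height_gt0 x.
have hh : height x ^+ 2 = a ^+ 2 + x ord0 0 ^+ 2.
  by rewrite height_sqr a2 /dot; ring.
set y := u ord0 0 - _.
have E : gdot x u u = a ^+ 2 / height x ^+ 2 * y ^+ 2 + u ord0 1 ^+ 2 / a ^+ 2.
  rewrite gdot_dot.
  have -> : tcomp x u * tcomp x u = dot x u ^+ 2 / height x ^+ 2.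
    by rewrite /tcomp; field; rewrite gt_eqF.
  rewrite hh /y /dot; have : a ^+ 2 + x ord0 0 ^+ 2 != 0 by rewrite -hh expf_neq0// gt_eqF.
  have : a ^+ 2 != 0 by rewrite expf_neq0// gt_eqF.
  rewrite a2 => n1 n2; field; rewrite ?n1 ?n2//.
have e1 : 0 <= a ^+ 2 / height x ^+ 2 * y ^+ 2.
  by rewrite mulr_ge0 ?sqr_ge0// divr_ge0 ?sqr_ge0.
have e2 : 0 <= u ord0 1 ^+ 2 / a ^+ 2 by rewrite divr_ge0 ?sqr_ge0.
have abs (z b : R) : 0 <= b -> z ^+ 2 <= b ^+ 2 -> `|z| <= b.
  by move=> b0; rewrite -[z ^+ 2]real_normK ?num_real// ler_pXn2r ?nnegrE.
split; apply: abs.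
- by rewrite mulr_ge0// ltW.
- rewrite exprMn -ler_pdivrMr ?exprn_gt0//; lra.
- by rewrite mulr_ge0// divr_ge0// ltW.
- rewrite exprMn expr_div_n -ler_pdivrMr ?divr_gt0 ?exprn_gt0//.
  rewrite invf_div mulrC; lra.
Qed.

Lemma sqrt_det_metric x : Num.sqrt (\det (metric x)) = (height x)^-1.
Proof.
suff -> : \det (metric x) = (height x ^+ 2)^-1.
  by rewrite sqrtrV ?sqr_ge0// sqrtr_sqr gtr0_norm// height_gt0.
have s0 : 1 + (x ord0 0 ^+ 2 + x ord0 1 ^+ 2) != 0.
  by rewrite -(sum2 (fun i => x ord0 i ^+ 2)) gt_eqF // sum_sq_gt0.
rewrite (expand_det_row _ ord0) sum2 /cofactor !det_mx11 !mxE !sum2 height_sqr.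
rewrite /dot /= /bump /=.
have -> : lift (0 : 'I_2) (0 : 'I_1) = 1 by apply/val_inj.
have -> : lift (1 : 'I_2) (0 : 'I_1) = 0 by apply/val_inj.
rewrite ?eqxx ?[(1 == 0 :> 'I_2)]eqE ?[(0 == 1 :> 'I_2)]eqE /= -?expr2.
by field; rewrite ?addrA // in s0 *.
Qed.

End support.

(** * Transport of the datum by the flow *)

Section transport.
Context {R : realType}.

Lemma is_derive_comp_curve (V W : normedModType R) (F : V -> W) (g : R -> V)
    (s : R) (dg : V) : is_derive s (1 : R) g dg -> differentiable F (g s) ->
  is_derive s (1 : R) (fun z => F (g z)) ('D_dg F (g s)).
Proof.
move=> [dg1 dg2] dF.
have dg' : differentiable g s by apply/derivable1_diffP.
have dFg : differentiable (F \o g) s by exact: differentiable_comp.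
apply: DeriveDef; first exact: diff_derivable.
rewrite -[LHS]/('D_1 (F \o g) s) deriveE// diff_comp//= deriveE//; congr ('d F _ _).
by rewrite -deriveE.
Qed.

Lemma is_derive_graph (V : normedModType R) (g : R -> V) (s : R) (dg : V) :
  is_derive s (1 : R) g dg ->
  is_derive s (1 : R) (fun z => (z, g z) : R * V) (1, dg).
Proof.
move=> [dg1 dg2]; have dg' : differentiable g s by apply/derivable1_diffP.
have D : differentiable (fun z => (z, g z) : R * V) s by exact: differentiable_pair.
apply: DeriveDef; first exact: diff_derivable.
rewrite deriveE// diff_pair//=; congr (_, _); first by rewrite diff_val.
by rewrite -deriveE.
Qed.

Section joint.
Variables (f : R -> TH2 R -> R).
Let F := fun tp : R * TH2 R => f tp.1 tp.2.

Lemma derive_joint_time (s : R) (p : TH2 R) :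
  'D_((1, 0) : R * TH2 R) F (s, p) = derive1 (fun z => f z p) s.
Proof.
rewrite derive1E /derive /=.
have E (h : R) : h *: ((1, 0) : R * TH2 R) + (s, p) = (h%:A + s, p).
  by congr (_, _); rewrite /= scaler0 add0r.
by under [in LHS]eq_fun do rewrite E.
Qed.

Lemma derive_joint_space (s : R) (p w : TH2 R) :
  'D_((0, w) : R * TH2 R) F (s, p) = 'D_w (f s) p.
Proof.
rewrite /derive /=.
have E (h : R) : h *: ((0, w) : R * TH2 R) + (s, p) = (s, h *: w + p).
  by congr (_, _); rewrite /= scaler0 add0r.
by under [in LHS]eq_fun do rewrite E.
Qed.

Lemma derive_joint (s : R) (p w : TH2 R) : differentiable F (s, p) ->
  'D_((1, w) : R * TH2 R) F (s, p) = derive1 (fun z => f z p) s + 'D_w (f s) p.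
Proof.
move=> dF; rewrite -derive_joint_time -derive_joint_space !deriveE// -linearD.
by congr ('d F _ _); congr (_, _); rewrite ?addr0 ?add0r.
Qed.

Lemma C1_at_slice (s : R) : (forall p, C1_at F (s, p)) -> forall p, C1_at (f s) p.
Proof.
move=> CF p.
have dp q : differentiable (fun q : TH2 R => (s, q) : R * TH2 R) q.
  by apply: differentiable_pair; [exact: differentiable_cst|exact: ex_diff].
split.
  have [D2 _] := CF p.
  exact: (@differentiable_comp _ _ _ _ (fun q => (s, q)) F p (dp p) D2).
move=> w; have [_ /(_ (0, w)) cF] := CF p.
rewrite (_ : (fun q => _) =
  (fun tp => 'D_((0, w) : R * TH2 R) F tp) \o (fun q : TH2 R => (s, q) : R * TH2 R)).
  by apply: continuous_comp; [exact: (differentiable_continuous (dp p))|exact: cF].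
by apply/funext => q; rewrite /= derive_joint_space.
Qed.

End joint.

(** The solution is constant along the characteristics
[z |-> (z, flow (z - t) p)], by the equation for positive times and by
continuity down to time [0]. *)
Lemma vlasov_transport (f0 : TH2 R -> R) (f : R -> TH2 R -> R) :
  vlasov_solution f0 f -> forall t p, 0 < t -> f t p = f0 (flow (- t) p).
Proof.
move=> [cf C1f eqf f00] t p t0; rewrite -f00.
pose F := fun tp : R * TH2 R => f tp.1 tp.2.
pose g z := flow (z - t) p; pose G z := (z, g z) : R * TH2 R.
have dg (z : R) : is_derive z (1 : R) g (geodesic_field (g z)).
  have S : is_derive z (1 : R) (fun z : R => z - t) 1.
    have := is_deriveB (is_derive_id z (1 : R)) (is_deriveC_fun z (1 : R) t).
    by move=> H; apply: (is_derive_eq H); rewrite subr0.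
  have [d1 d2] := is_derive_flow (z - t) p.
  have := @is_derive_comp_curve _ _ (fun s => flow s p) (fun z => z - t) z 1 S.
  move=> H; apply: is_derive_eq; first by apply: H; apply/derivable1_diffP.
  exact: d2.
have dG (z : R) := is_derive_graph _ g z _ (dg z).
have cG : continuous G.
  move=> z; apply: differentiable_continuous; apply/derivable1_diffP.
  by case: (dG z).
have dFG (z : R) : 0 < z -> is_derive z (1 : R) (fun z => F (G z)) 0.
  move=> z0; have [dF _] := C1f z (g z) z0.
  have := @is_derive_comp_curve _ _ F G z _ (dG z) dF.
  by move=> H; apply: (is_derive_eq H); rewrite derive_joint// eqf.
have cFG : {within `[0, t], continuous (fun z => F (G z))}.
  apply/subspace_continuousP => z /= zt.
  move/subspace_continuousP : cf => /(_ (G z)) cf.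
  have : 0 <= (G z).1 by move: zt; rewrite /= in_itv /= => /andP[].
  move=> /cf; apply: cvg_comp => P /= wP.
  have H := cG z _ wP; change (nbhs z (fun y : R => y \in `[0, t] -> P (G y))).
  apply: (@filterS R (nbhs (z : R)) (nbhs_filter (z : R)) _ _ _ H) => y Hy yt.
  apply: Hy => /=.
  by move: yt; rewrite in_itv /= => /andP[].
have [|c _] := @MVT_segment R (fun z => F (G z)) (fun=> 0) 0 t (ltW t0) _ cFG.
  by move=> z; rewrite in_itv /= => /andP[z0 _]; exact: dFG.
rewrite mul0r => /eqP; rewrite subr_eq0 => /eqP.
by rewrite /F /G /g /= subrr flow0 sub0r.
Qed.

End transport.

(** * Integrals over the plane *)

Section plane_integrals.
Context {R : realType}.
Notation leb := (@lebesgue_measure R).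
Notation leb2 := (leb \x leb)%E.
Implicit Types (h : R * R -> R) (b : R).

(** Open sets of the plane are countable unions of rational boxes. *)
Lemma open_measurable_prod (U : set (R * R)) : open U -> measurable U.
Proof.
move=> oU.
pose box (q : (rat * rat) * (rat * rat)) : set (R * R) :=
  `]ratr q.1.1, ratr q.1.2[%classic `*` `]ratr q.2.1, ratr q.2.2[%classic.
have -> : U = \bigcup_(q in [set q | box q `<=` U]) box q.
  apply/seteqP; split=> [[x y] Uxy|z [q /= qU qz]]; last exact: qU.
  have : nbhs (x, y) U by move: oU; rewrite openE; apply.
  move=> [[A B] /= [/nbhs_ballP[e1 /= e10 HA] /nbhs_ballP[e2 /= e20 HB]] AB].
  have Q (c e : R) : 0 < e -> exists ab : rat * rat,
      [/\ ratr ab.1 < c, c < ratr ab.2 &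
      forall z, ratr ab.1 < z < ratr ab.2 -> ball c e z].
    move=> e0.
    have [a] := @rat_in_itvoo R (c - e) c ltac:(lra).
    have [b] := @rat_in_itvoo R c (c + e) ltac:(lra).
    rewrite !in_itv /= => /andP[b1 b2] /andP[a1 a2]; exists (a, b); split=> //= z.
    move=> /andP[z1 z2]; rewrite /ball /= ltr_distlC; apply/andP; split; lra.
  have [[a1 b1] /= [A1 A2 A3]] := Q x e1 e10.
  have [[a2 b2] /= [B1 B2 B3]] := Q y e2 e20.
  exists ((a1, b1), (a2, b2)).
    move=> [z1 z2] [] /=; rewrite !in_itv /= => H1 H2.
    by apply: AB; split=> /=; [apply/HA/A3|apply/HB/B3].
  by split; rewrite /= in_itv /= ?A1 ?A2 ?B1 ?B2.
rewrite bigcup_mkcond; apply: countable_bigcupT_measurable => // q.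
case: ifP => _ //; by apply: measurableX; exact: measurable_itv.
Qed.

Lemma continuous_measurable_prod h : continuous h -> measurable_fun setT h.
Proof.
move=> ch; apply: (measurability _ (RGenOpens.measurableE R)) => //.
move=> _ [_ [a [b ->] <-]]; rewrite setTI; apply: open_measurable_prod.
by move/continuousP : ch; apply; exact: interval_open.
Qed.

Definition box b : set (R * R) := `[- b, b]%classic `*` `[- b, b]%classic.

Lemma boxP b v : box b v <-> `|v.1| <= b /\ `|v.2| <= b.
Proof. by rewrite /box /= !in_itv /= -!ler_norml. Qed.

Lemma box_compact b : compact (box b).
Proof. by apply: compact_setX; exact: segment_compact. Qed.

Lemma box_measurable b : measurable (box b).
Proof. by apply: measurableX; exact: measurable_itv. Qed.

Lemma box_lty b : (leb2 (box b) < +oo)%E.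
Proof.
pose I : set R := `[- b, b]%classic.
rewrite [ltLHS](_ : _ = (leb I * leb I)%E); last first.
  by apply: product_measure1E; exact: measurable_itv.
rewrite /I !lebesgue_measure_itv /=.
by case: ifP => _; rewrite ?mule0 ?ltry// -EFinB -EFinM ltry.
Qed.

Lemma integrable_box_cst b (M : R) :
  leb2.-integrable setT (EFin \o (cst M \_ (box b))).
Proof.
rewrite -restrict_EFin.
apply: (@integrable_mkcond _ _ R leb2 (box b) (EFin \o cst M) (box_measurable b)).1.
apply: measurable_bounded_integrable => //; [exact: box_measurable|exact: box_lty|].
by exists `|M|; split; [exact: num_real|move=> y My v _; exact: ltW].
Qed.

Definition box_supported b h :=
  forall v, h v != 0 -> `|v.1| <= b /\ `|v.2| <= b.

Lemma compact_norm_bounded (T : topologicalType) (F : T -> R) (A : set T) :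
  continuous F -> compact A ->
  exists2 M, 0 <= M & forall x, A x -> `|F x| <= M.
Proof.
move=> cF cA.
have := compact_bounded (continuous_compact (continuous_subspaceT cF) cA).
move=> [M0 [_ HM]]; exists (`|M0| + 1); first by rewrite addr_ge0.
move=> x Ax; apply: (HM (`|M0| + 1)); last by exists x.
by rewrite (le_lt_trans (ler_norm _))// ltrDl.
Qed.

Lemma integrable_box h b : continuous h -> box_supported b h ->
  leb2.-integrable setT (EFin \o h).
Proof.
move=> ch hb.
have [M M0 HM] := compact_norm_bounded _ h _ ch (box_compact b).
have -> : EFin \o h = (EFin \o h) \_ (box b).
  apply/funext => v; rewrite patchE; case: ifPn => //= /negP nB.
  apply/eqP; rewrite eqe; apply/negPn/negP => /hb /boxP vb.
  by apply: nB; rewrite inE.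
apply: (@integrable_mkcond _ _ R leb2 (box b) (EFin \o h) (box_measurable b)).1.
apply: measurable_bounded_integrable; [exact: box_measurable|exact: box_lty| |].
- exact: measurable_funS (continuous_measurable_prod _ ch).
- exists M; split; first exact: num_real.
  by move=> x Mx v /HM /le_trans; apply; exact: ltW.
Qed.

(** A function of size at most [M] that vanishes off a parallelogram with a
horizontal side: by Tonelli, the sections by horizontal lines have length
[2 l] whatever the slope [m] of the other side. *)
Lemma Rintegral_parallelogram h (M k l c d : R) (m : R) :
  leb2.-integrable setT (EFin \o h) -> 0 <= M -> 0 <= k -> 0 <= l ->
  (forall v, `|h v| <= M) ->
  (forall v, h v != 0 -> `|v.2 - d| <= k /\ `|v.1 - c - m * (v.2 - d)| <= l) ->
  `|(\int[leb2]_v h v)%R| <= M * (2 * k) * (2 * l).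
Proof.
move=> ih M0 k0 l0 hM hs.
rewrite -lee_fin EFin_normr_Rintegral//.
have [mh _] := integrableP _ _ _ ih.
apply: (le_trans (le_abse_integral _ measurableT mh)).
have mah : measurable_fun setT ((fun v => `|(EFin \o h) v|%E) : R * R -> \bar R).
  exact: measurableT_comp.
rewrite fubini_tonelli2//.
have inner (y : R) : (fubini_G leb (fun v => `|(EFin \o h) v|) y
    <= (M * (2 * l))%:E * (\1_(`[(d - k)%R, (d + k)%R]%classic) y)%:E)%E.
  rewrite /fubini_G /=.
  have my : measurable_fun setT (fun x : R => `|(h (x, y))|%:E).
    apply/measurable_EFinP; apply: measurableT_comp => //.
    move/measurable_EFinP : mh => mh.
    by apply: measurableT_comp => //; exact: pair2_measurable.
  have [yd|yd] := boolP (y \in `[d - k, d + k]); last first.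
    rewrite indicE mem_setE (negbTE yd) mule0 (eq_integral (fun=> 0%E)).
      by rewrite integral0.
    move=> x _; apply/eqP; rewrite eqe normr_eq0; apply/negPn/negP => /hs[/= + _].
    by move: yd; rewrite in_itv /= ler_distl => /negP.
  rewrite indicE mem_setE yd mule1.
  pose e := c + m * (y - d).
  have -> : (M * (2 * l))%:E = (\int[leb]_(x in `[(e - l)%R, (e + l)%R]) (cst M%:E x))%E.
    rewrite integral_cst; last exact: measurable_itv.
    rewrite /= lebesgue_measure_itv /= lte_fin.
    case: ltP => H; last by (have -> : l = 0 by lra); rewrite mulr0 mulr0 mule0.
    by rewrite -EFinB -EFinM; congr (_%:E); congr (_ * _); lra.
  rewrite [leRHS]integral_mkcond; apply: ge0_le_integral => //.
  - by apply/(measurable_restrictT _ _).1 => //; exact: measurable_itv.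
  - move=> x _; rewrite patchE; case: ifPn; first by rewrite lee_fin.
    move=> xn; rewrite lee_fin normr_le0; apply/negPn/negP => /hs[/= _].
    rewrite ler_norml => H; move: xn; rewrite mem_setE in_itv /= /e => /negP; apply.
    by move: H => /andP[H1 H2]; apply/andP; split; lra.
apply: (@le_trans _ _ (\int[leb]_y ((M * (2 * l))%:E * (\1_(`[(d - k)%R, (d + k)%R]%classic) y)%:E))%E).
  apply: ge0_le_integral => //.
  - by move=> y _; apply: integral_ge0 => x _; exact: abse_ge0.
  - exact: measurable_fun_fubini_tonelli_G.
  - apply: measurable_funeM; apply/measurable_EFinP.
    by apply: measurable_indic; exact: measurable_itv.
  - by move=> y _; exact: inner.
rewrite ge0_integralZl ?lee_fin ?mulr_ge0//; last first.
- by apply/measurable_EFinP/measurable_indic; exact: measurable_itv.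
rewrite integral_indic//.
rewrite setIT /= lebesgue_measure_itv /= lte_fin.
case: ltP => H; last by rewrite mule0 lee_fin !mulr_ge0.
by rewrite -EFinB -EFinM lee_fin; nra.
Qed.

End plane_integrals.

Section divergence.
Context {R : realType}.
Notation leb := (@lebesgue_measure R).
Notation leb2 := (leb \x leb)%E.
Implicit Types (g dg : R -> R) (h dh : R * R -> R) (b : R).

Lemma derive_outside g dg b : (forall x : R, is_derive x (1 : R) g (dg x)) ->
  (forall x, b < `|x| -> g x = 0) -> forall x, b < `|x| -> dg x = 0.
Proof.
move=> D g0 x bx; have [_ <-] := D x.
rewrite (@near_eq_derive _ _ _ _ (fun=> 0)) ?derive_cst//.
have : \forall y \near x, b < `|y|.
  have /= := @norm_continuous _ R^o x; move=> /(_ _ (lt_nbhsr bx)); exact.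
apply: filterS; exact: g0.
Qed.

Lemma integral_derive0 g dg b : continuous dg ->
  (forall x : R, is_derive x (1 : R) g (dg x)) ->
  (forall x, b < `|x| -> g x = 0) -> (\int[leb]_x (dg x)%:E = 0)%E.
Proof.
move=> cdg D g0; have dg0 := derive_outside g dg b D g0.
have cg : continuous g.
  by move=> x; apply: differentiable_continuous; apply/derivable1_diffP; case: (D x).
pose c := `|b| + 1.
have bc : b < c by rewrite /c (le_lt_trans (ler_norm b))// ltrDl.
have c0 : 0 < c by rewrite /c ltr_wpDl.
have -> : (\int[leb]_x (dg x)%:E = \int[leb]_(x in `[(- c)%R, c]) (dg x)%:E)%E.
  rewrite [RHS]integral_mkcond; apply: eq_integral => x _.
  rewrite patchE; case: ifPn => //; rewrite mem_setE in_itv /= -ler_norml -ltNge.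
  by move=> cx; rewrite dg0// (lt_trans bc).
rewrite (@continuous_FTC2 _ dg g).
- by rewrite !g0 ?subee// ?normrN gtr0_norm.
- by lra.
- by apply: continuous_subspaceT.
- split.
  + by move=> x _; case: (D x).
  + by apply: cvg_at_right_filter; exact: cg.
  + by apply: cvg_at_left_filter; exact: cg.
- by move=> x _; rewrite derive1E; case: (D x).
Qed.

Lemma box_supported_dfst h dh b : box_supported b h ->
  (forall x y : R, is_derive x (1 : R) (fun z => h (z, y)) (dh (x, y))) ->
  box_supported b dh.
Proof.
move=> hb D [x y] /= dn0.
have [yb|yb] := leP `|y| b; last first.
  case/eqP: dn0; have [_ <-] := D x y.
  rewrite (_ : (fun z => _) = (fun=> 0)) ?derive_cst//.
  by apply/funext => z; apply/eqP/negPn/negP => /hb [_ /=]; rewrite leNgt yb.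
split=> //; rewrite leNgt; apply/negP => xb; case/eqP: dn0.
apply: (@derive_outside (fun z => h (z, y)) (fun z => dh (z, y)) b) => // z zb.
by apply/eqP/negPn/negP => /hb [/= + _]; rewrite leNgt zb.
Qed.

Lemma box_supported_dsnd h dh b : box_supported b h ->
  (forall x y : R, is_derive y (1 : R) (fun z => h (x, z)) (dh (x, y))) ->
  box_supported b dh.
Proof.
move=> hb D v vn0.
have H : box_supported b (fun v => dh (v.2, v.1)).
  apply: (@box_supported_dfst (fun v => h (v.2, v.1))) => [u /hb [] //|x y].
  exact: D.
by have := H (v.2, v.1); rewrite /= -surjective_pairing => /(_ vn0) [].
Qed.

(** The derivative of a compactly supported function along a coordinate axis has
integral zero on every line parallel to this axis. *)
Lemma Rintegral_dfst h dh b : continuous h -> continuous dh -> box_supported b h ->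
  (forall x y : R, is_derive x (1 : R) (fun z => h (z, y)) (dh (x, y))) ->
  (\int[leb2]_v dh v = 0)%R.
Proof.
move=> ch cdh hb D.
have idh := integrable_box dh b cdh (box_supported_dfst h dh b hb D).
rewrite /Rintegral -(integral21_prod_meas1 idh) (eq_integral (fun=> 0%E)).
  by rewrite integral0.
move=> y _; rewrite /fubini_G /=.
apply: (@integral_derive0 (fun z => h (z, y)) (fun z => dh (z, y)) b) => //.
- move=> x; apply: (@continuous_comp _ _ _ (fun z : R => (z, y)) dh); last exact: cdh.
  apply: differentiable_continuous; apply: differentiable_pair => //.
- by move=> x xb; apply/eqP/negPn/negP => /hb [/= + _]; rewrite leNgt xb.
Qed.

Lemma Rintegral_dsnd h dh b : continuous h -> continuous dh -> box_supported b h ->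
  (forall x y : R, is_derive y (1 : R) (fun z => h (x, z)) (dh (x, y))) ->
  (\int[leb2]_v dh v = 0)%R.
Proof.
move=> ch cdh hb D.
have idh := integrable_box dh b cdh (box_supported_dsnd h dh b hb D).
rewrite /Rintegral -(integral12_prod_meas1 idh) (eq_integral (fun=> 0%E)).
  by rewrite integral0.
move=> x _; rewrite /fubini_F /=.
apply: (@integral_derive0 (fun z => h (x, z)) (fun z => dh (x, z)) b) => //.
- move=> y; apply: (@continuous_comp _ _ _ (fun z : R => (x, z)) dh); last exact: cdh.
  apply: differentiable_continuous; apply: differentiable_pair => //.
- by move=> y yb; apply/eqP/negPn/negP => /hb [_ /=]; rewrite leNgt yb.
Qed.

End divergence.

(** * Derivative of the density along a curve *)

Section continuity_tools.
Context {R : realType} {T : topologicalType}.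

Lemma cts_comp (U V : topologicalType) (f : T -> U) (g : U -> V) :
  continuous f -> continuous g -> continuous (fun x => g (f x)).
Proof. by move=> cf cg x; apply: continuous_comp; [exact: cf|exact: cg]. Qed.

Lemma cts_cst (U : topologicalType) (u : U) : continuous (fun _ : T => u).
Proof. by move=> x; exact: cst_continuous. Qed.

Lemma cts_add (V : normedModType R) (f g : T -> V) :
  continuous f -> continuous g -> continuous (fun x => f x + g x).
Proof. by move=> cf cg x; apply: continuousD; [exact: cf|exact: cg]. Qed.

Lemma cts_mul (f g : T -> R) :
  continuous f -> continuous g -> continuous (fun x => f x * g x).
Proof. by move=> cf cg x; apply: continuousM; [exact: cf|exact: cg]. Qed.

Lemma cts_scale (V : normedModType R) (f : T -> R) (e : V) :
  continuous f -> continuous (fun x => f x *: e).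
Proof. by move=> cf x; apply: cvgZr_tmp; exact: cf. Qed.

Lemma cts_pair (U V : topologicalType) (f : T -> U) (g : T -> V) :
  continuous f -> continuous g -> continuous (fun x => (f x, g x)).
Proof. by move=> cf cg x; apply: cvg_pair; [exact: cf|exact: cg]. Qed.

Lemma cts_coord (f : T -> 'rV[R]_2) i :
  continuous f -> continuous (fun x => f x ord0 i).
Proof.
move=> cf x.
by apply: (@continuous_comp _ _ _ f (fun v : 'rV[R]_2 => v ord0 i));
  [exact: cf|exact: coord_continuous].
Qed.

Lemma vec2E (a b : R) : vec2 a b = a *: delta_mx 0 0 + b *: delta_mx 0 1.
Proof.
by apply/rowP => -[[|[|//]]] i; rewrite !mxE /=; ring.
Qed.

Lemma cts_vec2 (f g : T -> R) :
  continuous f -> continuous g -> continuous (fun x => vec2 (f x) (g x)).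
Proof.
move=> cf cg; rewrite (_ : (fun x => _) =
  (fun x => f x *: (delta_mx 0 0 : 'rV[R]_2) + g x *: (delta_mx 0 1 : 'rV[R]_2))).
  by apply: cts_add; apply: cts_scale.
by apply/funext => x; rewrite vec2E.
Qed.

Lemma cts_dot (f g : T -> 'rV[R]_2) :
  continuous f -> continuous g -> continuous (fun x => dot (f x) (g x)).
Proof. by move=> cf cg; apply: cts_add; apply: cts_mul; apply: cts_coord. Qed.

Lemma cts_height (f : T -> 'rV[R]_2) :
  continuous f -> continuous (fun x => height (f x)).
Proof.
move=> cf; apply: (@cts_comp _ _ (fun x => 1 + dot (f x) (f x)) Num.sqrt).
  by apply: cts_add; [exact: cts_cst|exact: cts_dot].
exact: sqrt_continuous.
Qed.

End continuity_tools.

Lemma cts_fst {U V : topologicalType} : continuous (@fst U V).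
Proof. by move=> x; exact: cvg_fst. Qed.

Lemma cts_snd {U V : topologicalType} : continuous (@snd U V).
Proof. by move=> x; exact: cvg_snd. Qed.

Lemma cts_derivable {R : realType} {V : normedModType R} (f df : R -> V) :
  (forall s : R, is_derive s (1 : R) f (df s)) -> continuous f.
Proof.
move=> D s; apply: differentiable_continuous; apply/derivable1_diffP.
by case: (D s).
Qed.

Lemma continuous_near_gt0 {R : realType} {T : topologicalType} (F : T -> R) (p : T) :
  continuous F -> 0 < F p -> \forall q \near p, 0 < F q.
Proof. by move=> cF Fp; have := cF p _ (lt_nbhsr Fp); exact. Qed.

Section density_derivative.
Context {R : realType}.
Notation leb := (@lebesgue_measure R).
Notation leb2 := (leb \x leb)%E.
Context (g : TH2 R -> R) (Q : R) (C1g : forall p, C1_at g p)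
  (suppg : forall p, g p != 0 -> gdot p.1 p.2 p.2 <= Q).
Implicit Types (x e : 'rV[R]_2) (p w : TH2 R) (v : R * R).

Let V v : 'rV[R]_2 := vec2 v.1 v.2.

Lemma dot_vec2 x (a b : R) : dot x (vec2 a b) = x ord0 0 * a + x ord0 1 * b.
Proof. by rewrite /dot vec2_0 vec2_1. Qed.

Lemma dot_delta x i : dot x (delta_mx 0 i) = x ord0 i.
Proof.
case: i => [[|[|//]]] i; rewrite /dot !mxE /= ?(mulr1, mulr0, addr0, add0r);
  by congr (x _ _); apply/val_inj.
Qed.

Let dg p : differentiable g p.
Proof. by case: (C1g p). Qed.

Let cg : continuous g.
Proof. by move=> p; exact: differentiable_continuous. Qed.

Let cD w : continuous (fun p => 'D_w g p).
Proof. by move=> p; case: (C1g p) => _; apply. Qed.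

Let DD w w' p : 'D_(w + w') g p = 'D_w g p + 'D_w' g p.
Proof. by rewrite !deriveE// linearD. Qed.

Let DZ (c : R) w p : 'D_(c *: w) g p = c * 'D_w g p.
Proof. by rewrite !deriveE// linearZ. Qed.

(** The condition [gdot p.1 p.2 p.2 <= Q] is closed, so it passes from [g] to its
derivatives. *)
Lemma derive_supp p w : 'D_w g p != 0 -> gdot p.1 p.2 p.2 <= Q.
Proof.
apply: contraNT; rewrite -ltNge => Qp; apply/eqP.
pose F (q : TH2 R) : R := (1 + dot q.1 q.1) * dot q.2 q.2
  + (- 1) * (dot q.1 q.2 * dot q.1 q.2) + (- Q) * (1 + dot q.1 q.1).
have cF : continuous F.
  have c1 : continuous (fun q : TH2 R => 1 + dot q.1 q.1).
    by apply: cts_add; [exact: cts_cst|apply: cts_dot; exact: cts_fst].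
  apply: cts_add; first apply: cts_add; apply: cts_mul => //.
  - by apply: cts_dot; exact: cts_snd.
  - exact: cts_cst.
  - by apply: cts_mul; apply: cts_dot; (exact: cts_fst || exact: cts_snd).
  - exact: cts_cst.
have FE q : F q = height q.1 ^+ 2 * (gdot q.1 q.2 q.2 - Q).
  have := height_tcomp q.1 q.2; rewrite gdot_dot /F -!height_sqr => <-; ring.
have Fp : 0 < F p by rewrite FE mulr_gt0 ?exprn_gt0 ?height_gt0// subr_gt0.
rewrite (@near_eq_derive _ _ _ _ (fun=> 0)) ?derive_cst//.
have := @continuous_near_gt0 _ _ F p cF Fp; apply: filterS => q.
rewrite FE pmulr_rgt0 ?exprn_gt0 ?height_gt0// subr_gt0 => Fq.
by apply/eqP/negPn/negP => /suppg; rewrite leNgt Fq.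
Qed.

(** Velocities of bounded length over points of bounded height have bounded
coordinates; this makes the support uniformly compact along a curve of base
points. *)
Lemma gdot_box x v (H : R) : height x <= H -> gdot x (V v) (V v) <= Q ->
  `|v.1| <= 1 + H ^+ 2 * `|Q| /\ `|v.2| <= 1 + H ^+ 2 * `|Q|.
Proof.
move=> hH vQ; set b := H ^+ 2 * `|Q|.
have H0 : 0 <= H by rewrite (le_trans _ hH)// ltW// height_gt0.
have b0 : 0 <= b by rewrite mulr_ge0// sqr_ge0.
have vb : dot (V v) (V v) <= b.
  rewrite (le_trans (dot_le_gdot x _))// ler_pM ?sqr_ge0 ?gdot_ge0//.
    by rewrite ler_pXn2r ?nnegrE// ltW// height_gt0.
  by rewrite (le_trans vQ)// ler_norm.
have bb : b <= (1 + b) ^+ 2 by nra.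
move: vb; rewrite dot_vec2 vec2_0 vec2_1 => vb.
have := sqr_ge0 v.1; have := sqr_ge0 v.2; rewrite !expr2 => s2 s1.
have abs (z : R) : z ^+ 2 <= (1 + b) ^+ 2 -> `|z| <= 1 + b.
  by rewrite -[z ^+ 2]real_normK ?num_real// ler_pXn2r ?nnegrE// addr_ge0.
by split; apply: abs; rewrite (le_trans _ bb)// expr2; lra.
Qed.

Let boxh x : R := 1 + height x ^+ 2 * `|Q|.

Let box_g x : box_supported (boxh x) (fun v => g (x, V v)).
Proof. by move=> v /suppg /= /(gdot_box x v _ (lexx _)). Qed.

Let box_D x w : box_supported (boxh x) (fun v => 'D_w g (x, V v)).
Proof. by move=> v /derive_supp /= /(gdot_box x v _ (lexx _)). Qed.

Let cV : continuous V.
Proof. by apply: cts_vec2; [exact: cts_fst|exact: cts_snd]. Qed.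

Let cxV x : continuous (fun v => (x, V v)).
Proof. by apply: cts_pair; [exact: cts_cst|exact: cV]. Qed.

Lemma fibre_integrable x :
  leb2.-integrable setT (EFin \o (fun v => g (x, V v))).
Proof.
apply: (@integrable_box _ _ (boxh x)); last exact: box_g.
exact: (cts_comp _ _ _ _ (cxV x) cg).
Qed.

Lemma fibre_derive_integrable x w :
  leb2.-integrable setT (EFin \o (fun v => 'D_w g (x, V v))).
Proof.
apply: (@integrable_box _ _ (boxh x)); last exact: box_D.
exact: (cts_comp _ _ _ _ (cxV x) (cD w)).
Qed.

Lemma fibre_dot_derive_integrable x w :
  leb2.-integrable setT (EFin \o (fun v => dot x (V v) * 'D_w g (x, V v))).
Proof.
apply: (@integrable_box _ _ (boxh x)); last first.
  by move=> v; rewrite mulf_eq0 negb_or => /andP[_]; exact: box_D.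
apply: cts_mul; last exact: (cts_comp _ _ _ _ (cxV x) (cD w)).
by apply: cts_dot; [exact: cts_cst|exact: cV].
Qed.

Lemma derive_boost_fieldE x e v : 'D_(boost_field e (x, V v)) g (x, V v) =
  height x * 'D_((e, 0) : TH2 R) g (x, V v)
  + (height x)^-1 * (dot x (V v) * 'D_((0, e) : TH2 R) g (x, V v)).
Proof.
rewrite (_ : boost_field e (x, V v) = height x *: ((e, 0) : TH2 R)
  + tcomp x (V v) *: ((0, e) : TH2 R)).
  by rewrite DD !DZ /tcomp; ring.
by congr (_, _); rewrite /= ?scaler0 ?addr0 ?add0r.
Qed.

Lemma fibre_derive_integrableZ x w (c : R) :
  leb2.-integrable setT (EFin \o (fun v => c * 'D_w g (x, V v))).
Proof.
rewrite (_ : _ \o _ = (fun v => c%:E * ('D_w g (x, V v))%:E)%E)//.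
by apply: integrableZl => //; exact: fibre_derive_integrable.
Qed.

Lemma fibre_dot_derive_integrableZ x w (c : R) :
  leb2.-integrable setT (EFin \o (fun v => c * (dot x (V v) * 'D_w g (x, V v)))).
Proof.
rewrite (_ : _ \o _ = (fun v => c%:E * (dot x (V v) * 'D_w g (x, V v))%:E)%E)//.
by apply: integrableZl => //; exact: fibre_dot_derive_integrable.
Qed.

Lemma fibre_boost_integrable x e :
  leb2.-integrable setT (EFin \o (fun v => 'D_(boost_field e (x, V v)) g (x, V v))).
Proof.
rewrite (_ : _ \o _ = (fun v => (height x * 'D_((e, 0) : TH2 R) g (x, V v))%:E
  + ((height x)^-1 * (dot x (V v) * 'D_((0, e) : TH2 R) g (x, V v)))%:E)%E).
  apply: integrableD => //; first exact: fibre_derive_integrableZ.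
  exact: fibre_dot_derive_integrableZ.
by apply/funext => v; rewrite /= derive_boost_fieldE.
Qed.

(** Integration by parts in the fibre: the weight [dot x v] has derivative
[dot x e] in direction [e]. *)
Lemma fibre_by_parts x e :
  (\int[leb2]_v (dot x (V v) * 'D_((0, e) : TH2 R) g (x, V v)))%R =
  - dot x e * (\int[leb2]_v g (x, V v))%R.
Proof.
have ch : continuous (fun v => dot x (V v) * g (x, V v)).
  apply: cts_mul; last exact: (cts_comp _ _ _ _ (cxV x) cg).
  by apply: cts_dot; [exact: cts_cst|exact: cV].
have hb : box_supported (boxh x) (fun v => dot x (V v) * g (x, V v)).
  by move=> v; rewrite mulf_eq0 negb_or => /andP[_]; exact: box_g.
have key i : (\int[leb2]_v (x ord0 i * g (x, V v)
    + dot x (V v) * 'D_((0, delta_mx 0 i) : TH2 R) g (x, V v)))%R = 0.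
  have cdh : continuous (fun v => x ord0 i * g (x, V v)
      + dot x (V v) * 'D_((0, delta_mx 0 i) : TH2 R) g (x, V v)).
    apply: cts_add; apply: cts_mul.
    - exact: cts_cst.
    - exact: (cts_comp _ _ _ _ (cxV x) cg).
    - by apply: cts_dot; [exact: cts_cst|exact: cV].
    - exact: (cts_comp _ _ _ _ (cxV x) (cD _)).
  have D (c : R -> R * R) (s : R) :
      (forall z, V (c z) = V (c s) + (z - s) *: delta_mx 0 i) ->
      is_derive s (1 : R) (fun z => dot x (V (c z)) * g (x, V (c z)))
        (x ord0 i * g (x, V (c s))
          + dot x (V (c s)) * 'D_((0, delta_mx 0 i) : TH2 R) g (x, V (c s))).
    move=> cE.
    have S : is_derive s (1 : R) (fun z : R => z - s) 1.
      have := is_deriveB (is_derive_id s (1 : R)) (is_deriveC_fun s (1 : R) s).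
      by move=> H; apply: (is_derive_eq H); rewrite subr0.
    have dc : is_derive s (1 : R) (fun z => (x, V (c z)) : TH2 R) (0, delta_mx 0 i).
      have := is_deriveD (is_derive_cst ((x, V (c s)) : TH2 R) s (1 : R))
        (is_derive_scale ((0, delta_mx 0 i) : TH2 R) S).
      rewrite (_ : (_ + _)%R = (fun z => (x, V (c z)) : TH2 R)).
        by move=> H; apply: (is_derive_eq H); rewrite add0r scale1r.
      apply/funext => z; rewrite (cE z); congr (_, _) => /=.
      by rewrite scaler0 addr0.
    have d2 := is_derive_comp_curve _ _ g _ s _ dc (dg _).
    have d1 : is_derive s (1 : R) (fun z => dot x (V (c z))) (x ord0 i).
      have := is_deriveD_fun (is_deriveC_fun s (1 : R) (dot x (V (c s))))
         (is_deriveM_fun S (is_deriveC_fun s (1 : R) (x ord0 i))).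
      rewrite (_ : (fun y => dot x (V (c s)) + (y - s) * x ord0 i)
                 = (fun z => dot x (V (c z)))).
        by move=> H; apply: (is_derive_eq H); ring.
      apply/funext => z; rewrite (cE z) dotDr dotZr; congr (_ + _ * _).
      by rewrite dot_delta.
    have := is_deriveM_fun d1 d2; move=> H; apply: (is_derive_eq H); ring.
  case: i cdh D => [[|[|//]]] i cdh D.
  - apply: (Rintegral_dfst _ _ (boxh x) ch cdh hb) => a b.
    apply: (D (fun z => (z, b))) => z; rewrite /V /= !vec2E.
    have -> : Ordinal i = 0 by apply/val_inj.
    by apply/rowP => j; rewrite !mxE; ring.
  - apply: (Rintegral_dsnd _ _ (boxh x) ch cdh hb) => a b.
    apply: (D (fun z => (a, z))) => z; rewrite /V /= !vec2E.
    have -> : Ordinal i = 1 by apply/val_inj.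
    by apply/rowP => j; rewrite !mxE; ring.
have key' i : (\int[leb2]_v (dot x (V v) * 'D_((0, delta_mx 0 i) : TH2 R) g (x, V v)))%R
    = - x ord0 i * (\int[leb2]_v g (x, V v))%R.
  have := key i; rewrite RintegralD//.
  - by rewrite RintegralZl ?fibre_integrable// => /eqP; rewrite addrC addr_eq0 => /eqP ->; rewrite mulNr.
  - rewrite (_ : _ \o _ = (fun v => (x ord0 i)%:E * (g (x, V v))%:E)%E)//.
    by apply: integrableZl => //; exact: fibre_integrable.
  - exact: fibre_dot_derive_integrable.
have eE : ((0, e) : TH2 R) = e ord0 0 *: ((0, delta_mx 0 0) : TH2 R)
    + e ord0 1 *: ((0, delta_mx 0 1) : TH2 R).
  congr (_, _); first by rewrite /= !scaler0 addr0.
  by rewrite /= -vec2E; apply/rowP => -[[|[|//]]] i; rewrite !mxE /=; congr (e _ _); apply/val_inj.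
rewrite (@eq_Rintegral _ _ _ leb2 setT (fun v =>
   e ord0 0 * (dot x (V v) * 'D_((0, delta_mx 0 0) : TH2 R) g (x, V v)) +
   e ord0 1 * (dot x (V v) * 'D_((0, delta_mx 0 1) : TH2 R) g (x, V v)))); last first.
  by move=> v _; rewrite eE DD !DZ; ring.
rewrite RintegralD//; try exact: fibre_dot_derive_integrableZ.
rewrite !RintegralZl//; try exact: fibre_dot_derive_integrable.
rewrite !key'.
by rewrite [dot x e]/dot; ring.
Qed.


Section along_a_curve.
Context (c c' : R -> 'rV[R]_2) (dc : forall s : R, is_derive s (1 : R) c (c' s))
  (cc' : continuous c').

Let cc : continuous c.
Proof. exact: cts_derivable dc. Qed.

Let dcw (w : 'rV[R]_2) (s : R) : is_derive s (1 : R) (fun z => (c z, w) : TH2 R) (c' s, 0).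
Proof.
have [d1 d2] := dc s.
have D : differentiable (fun z => (c z, w) : TH2 R) s.
  by apply: differentiable_pair; [exact/derivable1_diffP|exact: differentiable_cst].
apply: DeriveDef; first exact: diff_derivable.
rewrite deriveE// diff_pair//=; last exact/derivable1_diffP.
congr (_, _); last by rewrite diff_cst.
by rewrite -deriveE//; exact/derivable1_diffP.
Qed.

Lemma is_derive_fibre_integral (a : R) :
  is_derive a (1 : R) (fun s => \int[leb2]_v g (c s, V v))%R
    (\int[leb2]_v 'D_((c' a, 0) : TH2 R) g (c a, V v))%R.
Proof.
have [H H0 HH] := compact_norm_bounded _ _ _ (cts_height _ cc)
  (@segment_compact R (a - 1) (a + 1)).
pose b := 1 + H ^+ 2 * `|Q|.
pose f (s : R) v := g (c s, V v).
pose df (s : R) v := 'D_((c' s, 0) : TH2 R) g (c s, V v).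
have Df (s : R) v : is_derive s (1 : R) (f^~ v) (df s v).
  exact: is_derive_comp_curve (dcw (V v) s) (dg _).
have d1f s v : partial1of2 f s v = df s v.
  by rewrite partial1of2E; case: (Df s v).
have out s v : a - 1 <= s <= a + 1 -> df s v != 0 -> box b v.
  move=> sI /derive_supp /= cQ; apply/boxP; apply: gdot_box cQ.
  by rewrite (le_trans (ler_norm _))// HH//= in_itv.
have cdf : continuous (fun sv : R * (R * R) => df sv.1 sv.2).
  have cdir i : continuous (fun sv : R * (R * R) => c' sv.1 ord0 i
      * 'D_((delta_mx 0 i, 0) : TH2 R) g (c sv.1, V sv.2)).
    apply: cts_mul.
      by apply: cts_coord; apply: (cts_comp _ _ fst) => //; exact: cts_fst.
    apply: (cts_comp _ _ (fun sv : R * (R * R) => (c sv.1, V sv.2))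
      (fun p => 'D_((delta_mx 0 i, 0) : TH2 R) g p)); last exact: cD.
    apply: cts_pair; first by apply: (cts_comp _ _ fst) => //; exact: cts_fst.
    by apply: (cts_comp _ _ snd) => //; exact: cts_snd.
  have := cts_add _ _ _ (cdir 0) (cdir 1).
  rewrite (_ : (fun _ => _ + _) = (fun sv : R * (R * R) => df sv.1 sv.2))//.
  apply/funext => sv; rewrite /df -!DZ -DD; congr ('D_ _ _ _).
  congr (_, _); last by rewrite /= !scaler0 addr0.
  by rewrite /= -vec2E; apply/rowP => -[[|[|//]]] i; rewrite !mxE /=;
    congr (c' _ _ _); apply/val_inj.
have [M M0 HM] : exists2 M, 0 <= M &
    forall s v, a - 1 <= s <= a + 1 -> box b v -> `|df s v| <= M.
  have cpt := compact_setX (@segment_compact R (a - 1) (a + 1)) (box_compact b).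
  have [M M0 HM] := compact_norm_bounded _ _ _ cdf cpt.
  by exists M => // s v sI vb; apply: (HM (s, v)); split=> //=; rewrite in_itv.
have Ia : `]a - 1, a + 1[%classic a by rewrite /= in_itv /=; apply/andP; split; lra.
have If s : `]a - 1, a + 1[%classic s -> leb2.-integrable setT (EFin \o f s).
  by move=> _; exact: fibre_integrable.
have If' s v : `]a - 1, a + 1[%classic s -> setT v -> derivable (f^~ v) s 1.
  by move=> _ _; case: (Df s v).
pose G := cst M \_ (box b).
have G0 v : 0 <= G v by rewrite /G patchE; case: ifP.
have IG : leb2.-integrable setT (EFin \o G) := integrable_box_cst b M.
have Gub s v : `]a - 1, a + 1[%classic s -> setT v -> `|partial1of2 f s v| <= G v.
  rewrite /= in_itv /= => /andP[s1 s2] _; rewrite d1f /G patchE.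
  have sI : a - 1 <= s <= a + 1 by rewrite !ltW.
  case: ifPn => [|vn]; first by rewrite inE; exact: HM.
  rewrite normr_le0; apply/negPn/negP => /(out _ _ sI) vb.
  by move: vn; rewrite notin_setE.
have D1 := derivable_under_integral measurableT Ia If If' G0 IG Gub.
have := differentiation_under_integral measurableT Ia If If' G0 IG Gub.
rewrite derive1E => D2; apply: DeriveDef; first exact: D1.
by rewrite D2; apply: eq_Rintegral => v _; rewrite d1f.
Qed.

Lemma is_derive_height_curve (a : R) :
  is_derive a (1 : R) (fun s => height (c s)) (dot (c a) (c' a) / height (c a)).
Proof.
have dci i : is_derive a (1 : R) (fun s => c s ord0 i) (c' a ord0 i).
  have := is_derive_comp_curve _ _ (fun y : 'rV[R]_2 => y ord0 i) c a _ (dc a)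
    (differentiable_coord _ _ _).
  by have [_ ->] := @is_derive_coord R (c a) (c' a) i.
have D : is_derive a (1 : R) (fun s => 1 + dot (c s) (c s)) (2 * dot (c a) (c' a)).
  have := is_deriveD_fun (is_deriveC_fun a (1 : R) 1)
    (is_deriveD_fun (is_deriveM_fun (dci 0) (dci 0)) (is_deriveM_fun (dci 1) (dci 1))).
  by move=> H; apply: (is_derive_eq H); rewrite /dot; ring.
have p0 : 0 < 1 + dot (c a) (c a) by rewrite ltr_pwDl// dot_ge0.
have := @is_derive1_comp R (@Num.sqrt R) (fun s => 1 + dot (c s) (c s)) a _ _
  (is_derive1_sqrt p0) D.
move=> H; apply: (is_derive_eq H); rewrite -[Num.sqrt _]/(height (c a)).
by field; rewrite gt_eqF// height_gt0.
Qed.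

(** The derivative of the volume density [(height x)^-1] of the fibre and the
vertical part of the lifted boost field cancel by [fibre_by_parts].  One factor
[(height x)^-1] is the volume density, the other one turns the boost field into
the velocity of the curve. *)
Lemma is_derive_density (a : R) :
  is_derive a (1 : R) (fun s => density g (c s))
   ((height (c a))^-1 ^+ 2
     * \int[leb2]_v 'D_(boost_field (c' a) (c a, V v)) g (c a, V v))%R.
Proof.
have E s : density g (c s) = (height (c s))^-1 * (\int[leb2]_v g (c s, V v))%R.
  rewrite /density sqrt_det_metric RintegralZr//; last exact: fibre_integrable.
  by rewrite mulrC.
rewrite (_ : (fun s => _) = (fun s => (height (c s))^-1 * (\int[leb2]_v g (c s, V v))%R)); last first.
  by apply/funext => s; rewrite E.
have h0 : height (c a) != 0 by rewrite gt_eqF// height_gt0.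
have := is_deriveM_fun (is_deriveV_fun (is_derive_height_curve a) h0)
  (is_derive_fibre_integral a).
move=> D; apply: (is_derive_eq D); set x := c a; set e := c' a.
rewrite [in RHS](@eq_Rintegral _ _ _ leb2 setT _ _ (fun v _ => derive_boost_fieldE x e v)).
rewrite RintegralD//; last 2 first.
- exact: fibre_derive_integrableZ.
- exact: fibre_dot_derive_integrableZ.
rewrite !RintegralZl//; last 2 first.
- exact: fibre_dot_derive_integrable.
- exact: fibre_derive_integrable.
rewrite fibre_by_parts; field.
exact: h0.
Qed.

End along_a_curve.

End density_derivative.

(** * Decay of fibre integrals *)

Section fibre_decay.
Context {R : realType}.
Notation leb := (@lebesgue_measure R).
Notation leb2 := (leb \x leb)%E.
Implicit Types (x u e : 'rV[R]_2) (p w : TH2 R) (v : R * R).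

Lemma compact_dot_bounded (K : set (TH2 R)) : compact K -> exists2 S : R, 0 <= S &
  forall p, K p -> dot p.1 p.1 <= S /\ dot p.2 p.2 <= S.
Proof.
move=> cK; pose F (p : TH2 R) : R := dot p.1 p.1 + dot p.2 p.2.
have cF : continuous F.
  by apply: cts_add; apply: cts_dot; (exact: cts_fst || exact: cts_snd).
have [M M0 HM] := compact_norm_bounded _ F _ cF cK.
exists M => // p Kp; have := HM p Kp.
rewrite ger0_norm; last by rewrite addr_ge0// dot_ge0.
by have := dot_ge0 p.1; have := dot_ge0 p.2; rewrite /F => h1 h2 h3; split; lra.
Qed.

Lemma gdot_le_dot x u : gdot x u u <= dot u u.
Proof. by rewrite gdot_dot lerBlDr lerDl -expr2 sqr_ge0. Qed.

Lemma dotD_le u1 u2 : dot (u1 + u2) (u1 + u2) <= 2 * (dot u1 u1 + dot u2 u2).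
Proof.
have := dot_ge0 (u1 - u2); rewrite -scaleN1r !(dotDl, dotDr, dotZl, dotZr).
rewrite (dotC u2 u1); lra.
Qed.

(** A crude bound for the square of the Sasaki length of the lifted boost field
over the set where [dot x x] and [dot v v] are at most [S]. *)
Definition boost_field_size (S : R) : R :=
  1 + S + 2 * (S ^+ 2 + 2 * (1 + S) * (S + S ^+ 3) * S).

Lemma sasaki_boost_field (S : R) e p : dot e e = 1 ->
  dot p.1 p.1 <= S -> dot p.2 p.2 <= S ->
  sasaki p (boost_field e p) <= boost_field_size S.
Proof.
case: p => x u /= e1 xS uS; rewrite /sasaki /boost_field /=.
set h := height x; set k := tcomp x u.
have S0 : 0 <= S := le_trans (dot_ge0 x) xS.
have hS : h ^+ 2 <= 1 + S by rewrite /h height_sqr lerD2l.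
have h2 := sqr_ge0 h.
have tS z : tcomp x z ^+ 2 <= S * dot z z.
  by rewrite (le_trans (tcomp_CS x z))// ler_pM ?dot_ge0 ?gdot_ge0 ?gdot_le_dot.
have kS : k ^+ 2 <= S ^+ 2.
  by rewrite (le_trans (tS u))// expr2 ler_wpM2l.
have teS : tcomp x e ^+ 2 <= S by rewrite (le_trans (tS e))// e1 mulr1.
have ueS : dot u e ^+ 2 <= S by rewrite (le_trans (dot_CS u e))// e1 mulr1.
rewrite GammaE; set c := gdot x u (h *: e).
have cE : c = h * (dot u e - k * tcomp x e).
  rewrite /c gdot_dot dotZr (_ : tcomp x (h *: e) = h * tcomp x e); first by rewrite -/k; ring.
  by rewrite /tcomp dotZr mulrA.
have cS : c ^+ 2 <= (1 + S) * (2 * (S + S ^+ 3)).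
  rewrite cE exprMn ler_pM ?sqr_ge0//.
  have kt : (k * tcomp x e) ^+ 2 <= S ^+ 3.
    by rewrite exprMn [leRHS]exprSr ler_pM ?sqr_ge0.
  have := sqr_ge0 (dot u e + k * tcomp x e); rewrite !expr2 in ueS kt *; nra.
rewrite /boost_field_size; apply: lerD.
  rewrite (le_trans (gdot_le_dot _ _))// dotZl dotZr e1 mulr1.
  by rewrite -expr2.
rewrite (le_trans (gdot_le_dot _ _))// (le_trans (dotD_le _ _))//.
rewrite ler_pM2l// !(dotZl, dotZr) e1 mulr1 -expr2 lerD//.
rewrite mulrA mulrNN -expr2 ler_pM ?sqr_ge0 ?dot_ge0//.
by rewrite (le_trans cS)//; lra.
Qed.

Lemma sasakiZ (c : R) p w : sasaki p (c *: w) = c ^+ 2 * sasaki p w.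
Proof.
have gZ x u : gdot x (c *: u) (c *: u) = c ^+ 2 * gdot x u u.
  rewrite !gdot_dot (_ : tcomp x (c *: u) = c * tcomp x u).
    by rewrite dotZl dotZr; ring.
  by rewrite /tcomp dotZr mulrA.
have GZ : Gamma p.1 p.2 (c *: w.1) = c *: Gamma p.1 p.2 w.1.
  rewrite !GammaE scalerA; congr (_ *: _).
  rewrite !gdot_dot (_ : tcomp p.1 (c *: w.1) = c * tcomp p.1 w.1).
    by rewrite dotZr; ring.
  by rewrite /tcomp dotZr mulrA.
by rewrite /sasaki /= GZ -scalerDr !gZ; ring.
Qed.

(** By homogeneity; the factor [M] instead of its square root is allowed by
[1 <= M]. *)
Lemma derive_sasaki_le (h : TH2 R -> R) p (N M : R) : differentiable h p ->
  (forall w, sasaki p w <= 1 -> `|'D_w h p| <= N) -> 1 <= M ->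
  forall w, sasaki p w <= M -> `|'D_w h p| <= M * N.
Proof.
move=> dh HN M1 w wM; have M0 : 0 < M by rewrite (lt_le_trans ltr01).
have -> : 'D_w h p = M * 'D_(M^-1 *: w) h p.
  by rewrite !deriveE// linearZ /= mulrA divff ?gt_eqF// mul1r.
rewrite normrM gtr0_norm// ler_pM2l//; apply: HN.
rewrite sasakiZ exprVn mulrC ler_pdivrMr ?exprn_gt0// mul1r (le_trans wM)//.
by rewrite expr2 ler_peMl// ltW.
Qed.

(** Differentiate [g (boost e s p) = f0 (boost e s (flow (- t) p))], a consequence
of [flow_boost], at [s = 0]; the flow itself is never differentiated in [p]. *)
Lemma derive_boost_transport (f0 g : TH2 R -> R) (t : R) e p :
  (forall q, differentiable f0 q) -> (forall q, differentiable g q) ->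
  (forall q, g q = f0 (flow (- t) q)) -> dot e e = 1 ->
  'D_(boost_field e p) g p =
    'D_(boost_field e (flow (- t) p)) f0 (flow (- t) p).
Proof.
move=> d0 dg gE e1; set q := flow (- t) p.
have H1 := is_derive_comp_curve _ _ g _ 0 _ (is_derive_boost e p) (dg _).
have H2 := is_derive_comp_curve _ _ f0 _ 0 _ (is_derive_boost e q) (d0 _).
rewrite boost0 in H1; rewrite boost0 in H2.
have E : (fun s => g (boost e s p)) = (fun s => f0 (boost e s q)).
  by apply/funext => s; rewrite gE flow_boost.
by rewrite E in H1; case: H1 => _ <-; case: H2 => _ <-.
Qed.

Lemma supp_neq0 (h : TH2 R -> R) p : h p != 0 -> supp h p.
Proof. by move=> hp; apply: subset_closure. Qed.

Lemma derive_out_supp (h : TH2 R -> R) p w : 'D_w h p != 0 -> supp h p.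
Proof.
move=> Dn; apply: contrapT => np; case/eqP: Dn.
rewrite (@near_eq_derive _ _ _ _ (fun=> 0)) ?derive_cst//.
have oC : open (~` supp h) by apply: closed_openC; exact: closed_closure.
have nC : nbhs p (~` supp h) by apply: open_nbhs_nbhs; split.
apply: (@filterS _ (nbhs p) (nbhs_filter p) _ _ _ nC) => q nq.
by apply/eqP/negPn/negP => /supp_neq0.
Qed.

(** The velocities over [x] that reach a fixed ball at time [- t] fill a set of
coordinate area of order [height x / t ^ 2], by [flow_support]; the factor
[height x] is the inverse of the volume density. *)
Lemma fibre_integral_le (t S M : R) x (h : R * R -> R) : 0 < t -> 0 <= M -> 0 <= S ->
  leb2.-integrable setT (EFin \o h) -> (forall v, `|h v| <= M) ->
  (forall v, h v != 0 -> let y := (flow (- t) (x, vec2 v.1 v.2)).1 in dot y y <= S) ->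
  `|(\int[leb2]_v h v)%R| <= 8 * S * M / t ^+ 2 * height x.
Proof.
move=> t0 M0 S0 ih hM hS; have [u Hu] := flow_support t x t0.
(* The radius of the ball of velocities given by [flow_support]. *)
pose r := Num.sqrt (2 * S / t ^+ 2).
have rr : r ^+ 2 = 2 * S / t ^+ 2.
  by rewrite sqr_sqrtr// mulr_ge0 ?mulr_ge0// invr_ge0 sqr_ge0.
have r0 : 0 <= r by exact: sqrtr_ge0.
have hx := height_gt0 x.
pose a := Num.sqrt (1 + x ord0 1 ^+ 2).
have a0 : 0 < a by rewrite sqrtr_gt0 ltr_pwDl// sqr_ge0.
have -> : 8 * S * M / t ^+ 2 * height x =
    M * (2 * (r * a)) * (2 * (r * (height x / a))).
  transitivity (4 * M * r ^+ 2 * height x); first by rewrite rr; ring.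
  by field; rewrite gt_eqF.
apply: (Rintegral_parallelogram h M (r * a) (r * (height x / a)) (u ord0 0)
   (u ord0 1) (x ord0 0 * x ord0 1 / a ^+ 2)) => //.
- by rewrite mulr_ge0// ltW.
- by rewrite mulr_ge0// ltW// divr_gt0.
move=> v hv; pose y := (flow (- t) (x, vec2 v.1 v.2)).1.
have yS : dot y y <= S := hS v hv.
have hy : height y - 1 <= S.
  rewrite lerBlDl -(@ler_pXn2r _ 2) ?nnegrE ?(ltW (height_gt0 _)) ?addr_ge0//.
  rewrite height_sqr (@le_trans _ _ (1 + S))// ?lerD2l//.
  by rewrite expr2 ler_peMl ?addr_ge0// lerDl.
have : gdot x (vec2 v.1 v.2 - u) (vec2 v.1 v.2 - u) <= r ^+ 2.
  rewrite (le_trans (Hu _))// rr ler_pM2r ?invr_gt0 ?exprn_gt0//.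
  by rewrite ler_pM2l.
move=> /(gdot_ball_parallelogram _ _ _ r0); rewrite -/a.
rewrite (_ : (vec2 v.1 v.2 - u) ord0 0 = v.1 - u ord0 0); last by rewrite !mxE.
by rewrite (_ : (vec2 v.1 v.2 - u) ord0 1 = v.2 - u ord0 1)// !mxE.
Qed.

End fibre_decay.

(** * Decay of the density *)

Section decay.
Context {R : realType}.
Notation leb := (@lebesgue_measure R).
Notation leb2 := (leb \x leb)%E.
Implicit Types (x u e : 'rV[R]_2) (p w : TH2 R) (v : R * R).

Section fixed_time.
Context (f0 g : TH2 R -> R) (t S : R) (t0 : 0 < t) (S0 : 0 <= S)
  (C1f0 : forall p, C1_at f0 p) (C1g : forall p, C1_at g p)
  (gE : forall p, g p = f0 (flow (- t) p))
  (f0S : forall p, supp f0 p -> dot p.1 p.1 <= S /\ dot p.2 p.2 <= S).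

(** The speed is constant along geodesics, and the metric is dominated by the
Euclidean one. *)
Lemma transported_support p : g p != 0 -> gdot p.1 p.2 p.2 <= S.
Proof.
rewrite gE => /supp_neq0 /f0S [_ q2]; have [_ _ sp] := flow_facts (- t) p.
by rewrite -speed_sqr -sp speed_sqr (le_trans (gdot_le_dot _ _)).
Qed.

Lemma density_decay (L : R) x : (forall p, `|f0 p| <= L) ->
  `|density g x| <= 8 * S * L / t ^+ 2.
Proof.
move=> fL; have h0 := height_gt0 x.
have ig := fibre_integrable g S C1g transported_support x.
rewrite /density sqrt_det_metric RintegralZr// normrM.
rewrite [X in _ * X]gtr0_norm ?invr_gt0// ler_pdivrMr//.
apply: fibre_integral_le => //.
- by rewrite (le_trans _ (fL (0, 0))).
- by move=> v; rewrite gE.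
- by move=> v; rewrite gE => /supp_neq0 /f0S [].
Qed.

Lemma density_derivable (c c' : R -> 'rV[R]_2) (a : R) :
  (forall s : R, is_derive s (1 : R) c (c' s)) -> continuous c' ->
  derivable (fun s => density g (c s)) a 1.
Proof.
move=> dc cc'.
by case: (is_derive_density g S C1g transported_support c c' dc cc' a).
Qed.

(** A curve whose velocity at [a] is [l] times a unit vector of the chart moves
[l / height] times as fast as the boost in the same direction. *)
Lemma density_derive_decay (N : R) (c c' : R -> 'rV[R]_2) (a l : R) e :
  (forall s : R, is_derive s (1 : R) c (c' s)) -> continuous c' ->
  dot e e = 1 -> 0 <= l -> c' a = l *: e ->
  (forall p w, sasaki p w <= 1 -> `|'D_w f0 p| <= N) ->
  `|derive1 (fun s => density g (c s)) a|
    <= l / height (c a) * (8 * S * ((1 + boost_field_size S) * N) / t ^+ 2).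
Proof.
move=> dc cc' e1 l0 ca fN.
have M0 : 0 <= boost_field_size S.
  by rewrite /boost_field_size !(addr_ge0, mulr_ge0, exprn_ge0).
have N0 : 0 <= N.
  have := fN (0, 0) 0; rewrite (_ : 0 = (0 : R) *: (0 : TH2 R)); last by rewrite scaler0.
  by rewrite sasakiZ expr0n mul0r ler01 => /(_ isT); exact: le_trans.
have [_ D] := is_derive_density g S C1g transported_support c c' dc cc' a.
rewrite derive1E D ca; set x := c a.
have h0 := height_gt0 x.
have df p : differentiable f0 p by case: (C1f0 p).
have dg p : differentiable g p by case: (C1g p).
have Bl p : boost_field (l *: e) p = l *: boost_field e p.
  by congr (_, _); rewrite /= !scalerA mulrC.
pose k v := 'D_(boost_field e (x, vec2 v.1 v.2)) g (x, vec2 v.1 v.2).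
have kE v : k v = 'D_(boost_field e (flow (- t) (x, vec2 v.1 v.2))) f0
    (flow (- t) (x, vec2 v.1 v.2)).
  exact: derive_boost_transport.
have kL v : k v = height x * 'D_((e, 0) : TH2 R) g (x, vec2 v.1 v.2)
  + (height x)^-1 * (dot x (vec2 v.1 v.2) * 'D_((0, e) : TH2 R) g (x, vec2 v.1 v.2)).
  exact: derive_boost_fieldE.
have ik : leb2.-integrable setT (EFin \o k).
  exact: fibre_boost_integrable transported_support _ _.
have -> : (\int[leb2]_v 'D_(boost_field (l *: e) (x, vec2 v.1 v.2)) g (x, vec2 v.1 v.2))%R
    = l * (\int[leb2]_v k v)%R.
  rewrite -RintegralZl//; apply: eq_Rintegral => v _.
  by rewrite Bl (deriveE _ (dg _)) linearZ /= /k (deriveE _ (dg _)).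
have kbound : `|(\int[leb2]_v k v)%R| <=
    8 * S * ((1 + boost_field_size S) * N) / t ^+ 2 * height x.
  apply: fibre_integral_le => //.
  - by rewrite mulr_ge0// addr_ge0.
  - move=> v; rewrite kE; set q := flow _ _.
    have [->|Dn] := eqVneq ('D_(boost_field e q) f0 q) 0.
      by rewrite normr0 mulr_ge0// addr_ge0.
    have [q1 q2] := f0S q (derive_out_supp _ _ _ Dn).
    apply: derive_sasaki_le => //; first by move=> w; exact: fN.
      by rewrite lerDl.
    by rewrite (le_trans (sasaki_boost_field S e q e1 q1 q2))// lerDr.
  - by move=> v; rewrite kE => /derive_out_supp /f0S [].
have hV : 0 <= (height x)^-1 ^+ 2 by rewrite exprn_ge0// invr_ge0 ltW.
rewrite normrM (ger0_norm hV) normrM (ger0_norm l0).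
rewrite (le_trans (ler_wpM2l hV (ler_wpM2l l0 kbound)))// le_eqVlt.
by apply/orP; left; apply/eqP; field; rewrite !gt_eqF.
Qed.

End fixed_time.

Lemma height_polar (r th : R) : height (polar r th) = cosh r.
Proof.
apply: heightE; first exact: cosh_gt0.
rewrite cosh2_sinh2 /polar dot_vec2 vec2_0 vec2_1; congr (_ + _).
by rewrite -[LHS]mulr1 -(cos2Dsin2 th); ring.
Qed.

Lemma is_derive_vec2 (A B : R -> R) (s a b : R) :
  is_derive s (1 : R) A a -> is_derive s (1 : R) B b ->
  is_derive s (1 : R) (fun z => vec2 (A z) (B z)) (vec2 a b).
Proof.
move=> dA dB; rewrite vec2E.
rewrite (_ : (fun z => _) = (fun z => A z *: (delta_mx 0 0 : 'rV[R]_2))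
   + (fun z => B z *: (delta_mx 0 1 : 'rV[R]_2))).
  by apply: is_deriveD; exact: is_derive_scale.
by apply/funext => z; rewrite vec2E.
Qed.

Lemma cts_cosh : continuous (@cosh R).
Proof. exact: cts_derivable (@is_derive_cosh R). Qed.

Lemma is_derive_polar_r (th s : R) : is_derive s (1 : R) (fun z => polar z th)
  (vec2 (cosh s * cos th) (cosh s * sin th)).
Proof.
apply: is_derive_vec2.
- have := is_deriveM_fun (is_derive_sinh s) (is_deriveC_fun s (1 : R) (cos th)).
  by move=> H; apply: (is_derive_eq H); ring.
- have := is_deriveM_fun (is_derive_sinh s) (is_deriveC_fun s (1 : R) (sin th)).
  by move=> H; apply: (is_derive_eq H); ring.
Qed.

Lemma is_derive_polar_theta (r s : R) : is_derive s (1 : R) (fun z => polar r z)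
  (vec2 (sinh r * - sin s) (sinh r * cos s)).
Proof.
exact: is_derive_vec2.
Qed.

Lemma Linf_norm_ge0 (h : TH2 R -> R) : (0 <= Linf_norm h)%E.
Proof.
apply: (@le_trans _ _ (`|h (0, 0)|%:E)); first by rewrite lee_fin.
by apply: ereal_sup_ubound; exists (0, 0).
Qed.

Lemma Linf_norm_ub (h : TH2 R -> R) p : (`|h p|%:E <= Linf_norm h)%E.
Proof. by apply: ereal_sup_ubound; exists p. Qed.

Lemma W1inf_norm_ub (h : TH2 R -> R) p w : sasaki p w <= 1 ->
  (`|'D_w h p|%:E <= W1inf_norm h)%E.
Proof.
move=> pw; rewrite /W1inf_norm; set X := ereal_sup _.
apply: (@le_trans _ _ X); first by apply: ereal_sup_ubound; exists (p, w).
by rewrite leeDr// Linf_norm_ge0.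
Qed.

Lemma W1inf_norm_ge0 (h : TH2 R -> R) : (0 <= W1inf_norm h)%E.
Proof.
apply: le_trans (W1inf_norm_ub h (0, 0) 0 _); first by rewrite lee_fin.
rewrite (_ : 0 = (0 : R) *: (0 : TH2 R)); last by rewrite scaler0.
by rewrite sasakiZ expr0n mul0r ler01.
Qed.

Lemma le_mule_of_real (X : \bar R) (C y : R) : (0 <= X)%E -> 0 < C ->
  (forall N : R, X = N%:E -> y <= C * N) -> (y%:E <= C%:E * X)%E.
Proof.
case: X => [N| |]//= X0 C0 H; first by rewrite -EFinM lee_fin H.
by rewrite gt0_muley ?lte_fin// leey.
Qed.

End decay.

Theorem theorem1p2 (R : realType) (K : set (TH2 R)) (hK : compact K) :
  exists2 C : R, 0 < C &
    forall (f0 : TH2 R -> R) (f : R -> TH2 R -> R),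
      (forall p : TH2 R, 0 <= f0 p) ->
      (forall p : TH2 R, C1_at f0 p) ->
      supp f0 = K ->
      (forall (t : R) (p : TH2 R), 0 <= t -> 0 <= f t p) ->
      vlasov_solution f0 f ->
      forall t : R, 1 <= t ->
        (forall x : H2 R,
           (`|density (f t) x|%:E <= (C / t ^+ 2)%:E * Linf_norm f0)%E) /\
        (forall r theta : R, 0 < r ->
           [/\ derivable (fun s : R => density (f t) (polar r s)) theta 1,
               (`|(sinh r)^-1 *
                  derive1 (fun s : R => density (f t) (polar r s)) theta|%:E
                <= (C / t)%:E * W1inf_norm f0)%E,
               derivable (fun s : R => density (f t) (polar s theta)) r 1
             & (`|derive1 (fun s : R => density (f t) (polar s theta)) r|%:E
                <= (C / t)%:E * W1inf_norm f0)%E]).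
Proof.
have [S S0 KS] := compact_dot_bounded K hK.
have M0 : 0 <= boost_field_size S.
  by rewrite /boost_field_size !(addr_ge0, mulr_ge0, exprn_ge0).
set M := boost_field_size S in M0.
have C0 : 0 < 8 * (1 + S) * (1 + M) by rewrite !mulr_gt0// ltr_pwDl.
exists (8 * (1 + S) * (1 + M)) => // f0 f _ C1f0 suppK _ sol t t1.
have t0 : 0 < t by rewrite (lt_le_trans ltr01).
have gE p := vlasov_transport f0 f sol t p t0.
have C1g : forall p, C1_at (f t) p.
  by apply: C1_at_slice => p; case: sol => _ H _ _; exact: H.
have f0S p : supp f0 p -> dot p.1 p.1 <= S /\ dot p.2 p.2 <= S.
  by rewrite suppK; exact: KS.
have tt : t <= t ^+ 2 by rewrite expr2 ler_peMl// ltW.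
have coef (N : R) : 0 <= N -> 8 * S * ((1 + M) * N) / t ^+ 2 <= 8 * (1 + S) * (1 + M) / t * N.
  move=> N0; rewrite [leLHS](_ : _ = 8 * S * (1 + M) * N / t ^+ 2); last by ring.
  rewrite [leRHS](_ : _ = 8 * (1 + S) * (1 + M) * N / t); last by ring.
  apply: ler_pM; first by rewrite !(mulr_ge0, addr_ge0).
  - by rewrite invr_ge0 exprn_ge0// ltW.
  - have SS : 8 * S <= 8 * (1 + S) by lra.
    by rewrite (ler_wpM2r N0)// ler_wpM2r// addr_ge0.
  - by rewrite lef_pV2 ?posrE ?exprn_gt0.
split.
  move=> x; apply: le_mule_of_real; first exact: Linf_norm_ge0.
    by rewrite divr_gt0// exprn_gt0.
  move=> L LE; have fL p : `|f0 p| <= L by rewrite -lee_fin -LE Linf_norm_ub.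
  have L0 : 0 <= L := le_trans (normr_ge0 _) (fL (0, 0)).
  rewrite (le_trans (density_decay f0 (f t) t S t0 S0 C1g gE f0S L x fL))//.
  rewrite [leRHS](_ : _ = 8 * (1 + S) * (1 + M) * L / t ^+ 2); last by ring.
  rewrite ler_pM2r ?invr_gt0 ?exprn_gt0// ler_wpM2r//.
  by nra.
move=> r th r0.
have sr0 : 0 < sinh r by rewrite (lt_le_trans r0)// sinh_ge_id// ltW.
have e1 : dot (vec2 (cos th) (sin th)) (vec2 (cos th) (sin th)) = 1 :> R.
  by rewrite dot_vec2 vec2_0 vec2_1 -!expr2 cos2Dsin2.
have e2 : dot (vec2 (- sin th) (cos th)) (vec2 (- sin th) (cos th)) = 1 :> R.
  by rewrite dot_vec2 vec2_0 vec2_1 mulrNN -!expr2 addrC cos2Dsin2.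
have cr : continuous (fun s => vec2 (cosh s * cos th) (cosh s * sin th)).
  by apply: cts_vec2; apply: cts_mul; (exact: cts_cosh || exact: cts_cst).
have ct : continuous (fun s => vec2 (sinh r * - sin s) (sinh r * cos s)).
  apply: cts_vec2; apply: cts_mul; try exact: cts_cst; last exact: continuous_cos.
  by move=> s; apply: continuousN; exact: continuous_sin.
have er : vec2 (cosh r * cos th) (cosh r * sin th) = cosh r *: vec2 (cos th) (sin th).
  by apply/rowP => i; rewrite !mxE; case: ifP.
have et : vec2 (sinh r * - sin th) (sinh r * cos th)
    = sinh r *: vec2 (- sin th) (cos th).
  by apply/rowP => i; rewrite !mxE; case: ifP.
have Dr N := density_derive_decay f0 (f t) t S t0 S0 C1f0 C1g gE f0S N
  (fun s => polar s th) _ r (cosh r) _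
  (is_derive_polar_r th) cr e1 (ltW (cosh_gt0 r)) er.
have Dt N := density_derive_decay f0 (f t) t S t0 S0 C1f0 C1g gE f0S N
  (fun s => polar r s) _ th (sinh r) _
  (is_derive_polar_theta r) ct e2 (ltW sr0) et.
have hr : 1 <= cosh r by rewrite -(height_polar r th); exact: height_ge1.
have ch0 := cosh_gt0 r.
have fN N : W1inf_norm f0 = N%:E -> forall p w, sasaki p w <= 1 -> `|'D_w f0 p| <= N.
  by move=> NE p w pw; rewrite -lee_fin -NE; exact: W1inf_norm_ub.
have N0 N : W1inf_norm f0 = N%:E -> 0 <= N.
  by move=> NE; rewrite -lee_fin -NE; exact: W1inf_norm_ge0.
have Ct : 0 < 8 * (1 + S) * (1 + M) / t by rewrite divr_gt0.
have dv := density_derivable f0 (f t) t S C1g gE f0S.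
split.
- exact: dv (is_derive_polar_theta r) ct.
- apply: le_mule_of_real; [exact: W1inf_norm_ge0|exact: Ct|move=> N NE].
  have BN : 0 <= 8 * S * ((1 + M) * N) / t ^+ 2.
    by rewrite !(mulr_ge0, addr_ge0, N0 N NE, invr_ge0, exprn_ge0) ?(ltW t0).
  have := Dt N (fN N NE); rewrite -/M height_polar => H.
  rewrite (le_trans _ (coef N (N0 N NE)))// normrM gtr0_norm ?invr_gt0//.
  rewrite mulrC ler_pdivrMr// (le_trans H)// mulrC.
  by rewrite ler_wpM2l// ler_pdivrMr// ler_peMr// ltW.
- exact: dv (is_derive_polar_r th) cr.
- apply: le_mule_of_real; [exact: W1inf_norm_ge0|exact: Ct|move=> N NE].
  have := Dr N (fN N NE); rewrite -/M height_polar divff ?gt_eqF// mul1r => H.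
  by rewrite (le_trans H)// coef// N0.
Qed.
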